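(* Let $x>0$ be real. For $0<a<1$, $$E_{a}(-x)\ge\frac12e^{-x^{\frac1a}} ,$$ and for $0<a<\frac12$, $$\frac{\sin\pi a}{\pi}\frac{\Gamma(a)}{x}-\frac{e^{-x^{\frac1a}}}{4a\pi}\,\frac{\sin2\pi a}{1+\cos\pi a}\ \ge\ E_{a}(-x)\ \ge\ \frac12e^{-x^{\frac1a}} .$$
   Context: $E_a(z)=\sum_{k=0}^{\infty}\frac{z^{k}}{\Gamma(1+ak)}$ is the Mittag-Leffler function. *)

(* Defs.v *)
From HB Require Import structures.
From mathcomp Require Import all_boot all_order all_algebra.
From mathcomp Require Import all_classical all_reals all_analysis.

Set Implicit Arguments.
Unset Strict Implicit.
Unset Printing Implicit Defensive.

Import Order.TTheory GRing.Theory Num.Theory.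
Import numFieldNormedType.Exports.

Local Open Scope classical_set_scope.
Local Open Scope ring_scope.

(* Euler's integral of the second kind; it is the Gamma function for 0 < s
   only (elsewhere the integral diverges and the value is junk). *)
Definition Gamma (R : realType) (s : R) : R :=
  \int[lebesgue_measure]_(t in `]0, +oo[) (t `^ (s - 1) * expR (- t)).

(* Meaningful for 0 < a, where the series converges for every z and Gamma is
   only evaluated at arguments >= 1. *)
Definition MittagLeffler (R : realType) (a z : R) : R :=
  limn (series (fun k : nat => z ^+ k / Gamma (1 + a * k%:R))).

(* Main.v *)
Require Import Defs.
From HB Require Import structures.
From mathcomp Require Import all_boot all_order all_algebra.
From mathcomp Require Import all_classical all_reals all_analysis.
From mathcomp Require Import measurable_realfun.
From mathcomp Require Import complex ring lra.

Set Implicit Arguments.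
Unset Strict Implicit.
Unset Printing Implicit Defensive.

Import Order.TTheory GRing.Theory Num.Theory.
Import numFieldNormedType.Exports.

Local Open Scope classical_set_scope.
Local Open Scope ring_scope.

(** Write b = 1 / a, v = pi a and c = cos v.  Everything follows from the spectral
representation [MittagLeffler_spectral]

  E_a(- x) = (sin v / v) * \int_0^oo exp (- u^b x^b) / (1 + 2 c u + u^2) du.

The density 1 / (1 + 2 c u + u^2) has total mass v / sin v, half of it on
[0, 1], where exp (- u^b x^b) >= exp (- x^b): this is the lower bound
([spectral_lower]).  If the denominator is replaced by 1, the integral is a
Gamma integral ([integral_expRNpow]); for c > 0 the part that is lost,
with integrand exp (- u^b x^b) (2 c u + u^2) / (1 + 2 c u + u^2), is nonnegative
and on [0, 1] at least exp (- x^b) c u / (1 + c): this is the upper bound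
([spectral_upper]).

To prove the representation put x = t^a and compare Laplace transforms in t.
The power series can be integrated term by term for r > 1 and yields
r^a / (r (1 + r^a)) ([laplace_ML]).  On the other side Tonelli gives
\int_0^oo du / ((1 + 2 c u + u^2) (r + u^b)) ([laplace_spectral]).  This
Stieltjes integral is usually found by residues.  Here the function

  P(z) = z (1 - z) / ((1 + l z) (1 - z^b))

is integrated along the ray z = u e^(i theta).  By the Cauchy-Riemann
equations the integral of Im P against du / u does not depend on theta
([ray_integral_cst]).  As the factor 1 - z cancels the zero of 1 - z^b at z = 1,
that integral tends to 0 when the ray approaches the real axis, so it vanishes
for all angles ([ray_integral_eq0]).  For theta = pi / b the number z^b = - u^b
is real, and the vanishing of the integral becomes the evaluation of the
Stieltjes integral up to a factor that is independent of r
([ray_identity], [stieltjes_kernel]).  A continuous function all of whose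
moments against the powers of exp (- t) vanish is zero ([exp_moments_eq0]), so
the two sides of the representation are proportional, and letting t tend to 0
gives the factor ([spectral_constant]). *)

(** * Integration on the positive half-line *)

Section RealDominated.
Context d (T : measurableType d) (R : realType) (mu : {measure set T -> \bar R}).

Lemma Rdominated_cvg (D : set T) (f_ : nat -> T -> R) (f g : T -> R) :
  measurable D -> (forall n, measurable_fun D (f_ n)) -> measurable_fun D f ->
  {ae mu, forall x, D x -> f_ ^~ x @ \oo --> f x} ->
  mu.-integrable D (EFin \o g) ->
  (forall n x, D x -> `|f_ n x| <= g x) ->
  \int[mu]_(x in D) f_ n x @[n --> \oo] --> \int[mu]_(x in D) f x.
Proof.
move=> mD mf_ mf f_f ig fg.
have if_ n : mu.-integrable D (EFin \o f_ n).
  apply: (le_integrable mD _ _ ig); first exact/measurable_EFinP.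
  by move=> x Dx /=; rewrite lee_fin (le_trans (fg _ _ Dx))// ler_norm.
have [] := @dominated_convergence _ _ _ mu D mD (fun n => EFin \o f_ n)
  (EFin \o f) (EFin \o g).
- by move=> n; exact/measurable_EFinP.
- exact/measurable_EFinP.
- by apply: filterS f_f => x + Dx => /(_ Dx) h; apply: cvg_EFin => //; exact: nearW.
- by [].
- by apply: aeW => x n Dx /=; rewrite lee_fin fg.
move=> i_f _ cf.
apply: fine_cvg; rewrite fineK; last exact: integrable_fin_num.
exact: cf.
Qed.

Lemma integrable_cmul (D : set T) (c : R) (f : T -> R) : measurable D ->
  mu.-integrable D (EFin \o f) -> mu.-integrable D (EFin \o (fun x => c * f x)).
Proof.
move=> mD jf; have := integrableZl mD c jf.
by congr (is_true (integrable _ _ _)); apply/funext => x /=; rewrite EFinM.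
Qed.

End RealDominated.

Section PositiveHalfLine.
Context {R : realType}.
Local Notation mu := (@lebesgue_measure R).
Local Notation D := (`]0, +oo[%classic : set R).

Lemma measurable_pos_continuous (f : R -> R) :
  (forall u : R, 0 < u -> {for u, continuous f}) -> measurable_fun D f.
Proof.
move=> cf; apply: subspace_continuous_measurable_fun => //.
apply: continuous_in_subspaceT => x /set_mem /=; rewrite in_itv/= andbT.
exact: cf.
Qed.

Lemma integrable_pos_le (f g : R -> R) : measurable_fun D f ->
  mu.-integrable D (EFin \o g) -> (forall u : R, 0 < u -> `|f u| <= g u) ->
  mu.-integrable D (EFin \o f).
Proof.
move=> mf ig fg; apply: (le_integrable _ _ _ ig) => //; first exact/measurable_EFinP.
move=> x /=; rewrite in_itv/= andbT lee_fin => x0.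
by rewrite (le_trans (fg _ x0))// ler_norm.
Qed.

(** By the fundamental theorem on the segments [1 / n, n], which exhaust the
half-line. *)
Lemma Rintegral_derive_pos0 (F f : R -> R) :
  (forall u : R, 0 < u -> is_derive u 1 F (f u)) ->
  (forall u : R, 0 < u -> {for u, continuous f}) ->
  mu.-integrable D (EFin \o f) ->
  F x @[x --> 0^'+] --> 0 -> F x @[x --> +oo] --> 0 ->
  \int[mu]_(x in D) f x = 0.
Proof.
move=> dF cf jf F0 Fy.
pose E (n : nat) : set R := `[n.+2%:R^-1, n.+2%:R]%classic.
have n1 (n : nat) : (1 : R) < n.+2%:R by rewrite ltr1n.
have n0 (n : nat) : (0 : R) < n.+2%:R by rewrite ltr0n.
have En n : n.+2%:R^-1 < n.+2%:R :> R.
  by rewrite (lt_trans _ (n1 n))// invf_lt1.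
have mf : measurable_fun D f by exact: measurable_pos_continuous.
have ED n : E n `<=` D.
  move=> x; rewrite /E /= !in_itv/= andbT => /andP[+ _].
  by apply: lt_le_trans; rewrite invr_gt0.
have int_E n : \int[mu]_(x in E n) f x = F n.+2%:R - F n.+2%:R^-1.
  rewrite /Rintegral (continuous_FTC2 (En n) (F := F)) ?fineB//.
  - apply: continuous_in_subspaceT => x /set_mem /ED /=.
    by rewrite in_itv/= andbT; exact: cf.
  - split.
    + move=> x /subset_itv_oo_cc /ED /=; rewrite in_itv/= andbT => x0.
      by have [] := dF _ x0.
    + have := dF n.+2%:R^-1; rewrite invr_gt0 => /(_ (n0 n))[+ _].
      by move=> /derivable1_diffP/differentiable_continuous; exact: cvg_at_right_filter.
    + have := dF n.+2%:R (n0 n) => -[+ _].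
      by move=> /derivable1_diffP/differentiable_continuous; exact: cvg_at_left_filter.
  - move=> x /subset_itv_oo_cc /ED /=; rewrite in_itv/= andbT => x0.
    by rewrite derive1E; have [_] := dF _ x0.
have lim0 : \int[mu]_(x in E n) f x @[n --> \oo] --> (0 : R).
  rewrite (funext int_E) -[X in _ --> X](subr0 0); apply: cvgB.
    apply: ((cvg_pinftyP F 0).1 Fy (fun n => n.+2%:R)).
    have := @cvgr_idn R; rewrite -(cvg_shiftn 2) /=.
    by under eq_fun do rewrite addn2.
  apply: ((cvg_at_rightP F 0 0).1 F0 (fun n => n.+2%:R^-1)).
  split; first by move=> n; rewrite invr_gt0.
  have := @cvg_harmonic R; rewrite -(cvg_shiftn 1) /=.
  by under eq_fun do rewrite addn1.
have lim1 : \int[mu]_(x in E n) f x @[n --> \oo] --> \int[mu]_(x in D) f x.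
  have -> : (fun n => \int[mu]_(x in E n) f x) = (fun n => \int[mu]_(x in D) (f \_ (E n)) x).
    apply/funext => n; rewrite -Rintegral_mkcondr; congr (Rintegral _ _ _).
    by rewrite setIidr.
  apply: (@Rdominated_cvg _ _ _ mu _ _ _ (fun x => `|f x|)) => //.
  - move=> n; apply/measurable_restrict => //; first exact: measurable_itv.
    by apply: measurable_funS mf => //; exact: subIsetl.
  - apply: aeW => x; rewrite /= in_itv/= andbT => x0.
    apply: cvg_near_cst; near=> n; rewrite patchE mem_set//= /E /= in_itv/=.
    have xn : x <= n%:R by near: n; exact: nbhs_infty_ger.
    have xVn : x^-1 <= n%:R by near: n; exact: nbhs_infty_ger.
    have nn2 : (n%:R : R) <= n.+2%:R by rewrite ler_nat -addn2 leq_addr.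
    rewrite (le_trans xn nn2) andbT invf_ple ?posrE//.
    exact: le_trans nn2.
  - exact: integrable_norm.
  - move=> n x Dx; rewrite /= patchE; case: ifP => // _.
    by rewrite normr0.
exact: (cvg_unique _ lim1 lim0).
Unshelve. all: by end_near. Qed.

(** Integrability read off from the value of the integral. *)
Lemma integrable_ge0_fin (f : R -> R) (E : set R) (l : R) : measurable E ->
  measurable_fun E f -> (forall x, E x -> 0 <= f x) ->
  (\int[mu]_(x in E) (f x)%:E = l%:E)%E -> mu.-integrable E (EFin \o f).
Proof.
move=> mE mf f0 fl; apply/integrableP; split; first exact/measurable_EFinP.
under eq_integral.
  move=> x /set_mem Ex; rewrite /= ger0_norm; last exact: f0.
  over.
by rewrite fl ltry.
Qed.

Lemma cvgy_powRN (p : R) : 0 < p -> x `^ (- p) @[x --> +oo] --> (0 : R).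
Proof.
move=> p0; apply/cvgr0Pnorm_lt => e e0; near=> x.
have xe : e `^ (- p^-1) < x by near: x; exact: nbhs_pinfty_gt.
have e1 : 0 < e `^ (- p^-1) by rewrite powR_gt0.
have x0 : 0 < x by exact: lt_trans xe.
rewrite ger0_norm ?powR_ge0// powRN invf_plt ?posrE ?powR_gt0//.
have -> : e^-1 = (e `^ (- p^-1)) `^ p.
  by rewrite -powRrM mulNr mulVf ?gt_eqF// powR_inv1// ltW.
by rewrite gt0_ltr_powR// nnegrE ltW.
Unshelve. all: by end_near. Qed.

Lemma continuous_powR_pos (p u : R) : 0 < u -> {for u, continuous (@powR R ^~ p)}.
Proof.
move=> u0; have [+ _] := is_derive1_powR p u0.
by move=> /derivable1_diffP/differentiable_continuous.
Qed.

Lemma integrable_powRN (b : R) : 1 < b ->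
  mu.-integrable `[1, +oo[ (EFin \o (fun u => u `^ (- b))).
Proof.
move=> b1.
have pc : forall u : R, 1 <= u -> {for u, continuous (@powR R ^~ (- b))}.
  by move=> u u1; apply: continuous_powR_pos; exact: lt_le_trans u1.
apply: (@integrable_ge0_fin _ _ (0 - (1 - b)^-1 * 1 `^ (1 - b))) => //.
- by apply: measurable_funTS; exact: measurable_powR.
- by move=> x _; exact: powR_ge0.
have := @ge0_continuous_FTC2y R (fun u => u `^ (- b))
  (fun u => (1 - b)^-1 * u `^ (1 - b)) 1 0.
apply.
- by move=> x _; exact: powR_ge0.
- apply: continuous_in_subspaceT => x /set_mem /=; rewrite in_itv/= andbT.
  exact: pc.
- rewrite -[X in _ --> X](mulr0 (1 - b)^-1); apply: cvgM; first exact: cvg_cst.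
  by rewrite -opprB; apply: cvgy_powRN; rewrite subr_gt0.
- move=> x x1; have x0 : 0 < x by exact: lt_trans x1.
  by have [+ _] := is_deriveZ (1 - b)^-1 (is_derive1_powR (1 - b) x0).
- have [+ _] := is_deriveZ (1 - b)^-1 (is_derive1_powR (1 - b) ltr01).
  move=> /derivable1_diffP/differentiable_continuous.
  exact: cvg_at_right_filter.
- move=> x; rewrite in_itv/= andbT => x1; have x0 : 0 < x by exact: lt_trans x1.
  rewrite derive1E; have [_] := is_deriveZ (1 - b)^-1 (is_derive1_powR (1 - b) x0).
  move=> ->; rewrite /GRing.scale /= mulrA mulVf ?mul1r.
    by congr (_ `^ _); ring.
  by rewrite subr_eq0 lt_eqF.
Qed.

Lemma integrable_pos_split (f : R -> R) : measurable_fun D f ->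
  mu.-integrable `]0, 1] (EFin \o f) -> mu.-integrable `[1, +oo[ (EFin \o f) ->
  mu.-integrable D (EFin \o f).
Proof.
move=> mf i1 i2.
have DE : D = `]0, 1] `|` `]1, +oo[ by rewrite -itv_bndbnd_setU// bnd_simp.
have {}i2 : mu.-integrable `]1, +oo[ (EFin \o f).
  apply: integrableS i2 => //; apply: subset_itvr; by rewrite bnd_simp.
apply/integrableP; split; first exact/measurable_EFinP.
rewrite DE ge0_integral_setU//=.
- move/integrableP : i1 => [_ /= ?]; move/integrableP : i2 => [_ /= ?].
  exact: lte_add_pinfty.
- by rewrite -DE; apply/measurable_EFinP; exact: measurableT_comp mf.
- rewrite disj_set2E; apply/eqP/seteqP; split => // x [] /=.
  by rewrite !in_itv/= andbT => /andP[_ x1]; rewrite ltNge x1.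
Qed.

Lemma continuous_oneDpowRV (b u : R) : 0 < u ->
  {for u, continuous (fun u : R => (1 + u `^ b)^-1)}.
Proof.
move=> u0; apply: cvgV; first by rewrite gt_eqF// ltr_pwDl// powR_ge0.
by apply: cvgD; [exact: cvg_cst|exact: continuous_powR_pos].
Qed.

Lemma integrable_oneDpowRV (b : R) : 1 < b ->
  mu.-integrable D (EFin \o (fun u => (1 + u `^ b)^-1)).
Proof.
move=> b1.
have D1 (u : R) : 0 < 1 + u `^ b by rewrite ltr_pwDl// powR_ge0.
have mf : measurable_fun D (fun u : R => (1 + u `^ b)^-1).
  apply: measurable_pos_continuous => u; exact: continuous_oneDpowRV.
apply: integrable_pos_split => //.
- apply: measurable_bounded_integrable => //.
  + by rewrite /= lebesgue_measure_itv/= lte_fin ltr01 -EFinD ltry.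
  + by apply: measurable_funS mf => //; exact: subset_itvl.
  + exists 1; split => // M M1 x _ /=.
    apply: le_trans (ltW M1); rewrite ger0_norm ?invr_ge0 ?(ltW (D1 x))//.
    by rewrite invf_le1// lerDl powR_ge0.
- apply: (le_integrable _ _ _ (integrable_powRN b1)) => //.
    apply/measurable_EFinP; apply: measurable_funS mf => //.
    by apply: subset_itvr; rewrite bnd_simp.
  move=> x /=; rewrite in_itv/= andbT => x1; have x0 : 0 < x by exact: lt_le_trans x1.
  rewrite lee_fin !ger0_norm ?invr_ge0 ?powR_ge0 ?(ltW (D1 x))// powRN.
  by rewrite lef_pV2 ?posrE ?powR_gt0// lerDr.
Qed.

End PositiveHalfLine.

Section PosSubstitution.
Variable R : realType.
Local Notation mu := (@lebesgue_measure R).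
Local Notation D := (`]0, +oo[%classic : set R).

(** Substitution on the segments [1 / n, n] and monotone convergence.  The identity
is between extended reals and [f] may blow up at 0, as the integrand of Gamma
does. *)
Lemma pos_substitution (F F' f : R -> R) :
  (forall u : R, 0 < u -> is_derive u 1 F (F' u)) ->
  (forall u : R, 0 < u -> 0 < F u) -> (forall u : R, 0 < u -> 0 < F' u) ->
  (forall u : R, 0 < u -> {for u, continuous F'}) ->
  F x @[x --> 0^'+] --> 0 -> F x @[x --> +oo] --> +oo ->
  (forall u : R, 0 < u -> {for u, continuous f}) ->
  (forall u : R, 0 < u -> 0 <= f u) ->
  (\int[mu]_(x in D) (f x)%:E = \int[mu]_(x in D) (f (F x) * F' x)%:E)%E.
Proof.
move=> dF F_gt0 F'0 cF' F0 Fy cf f0.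
pose E (n : nat) : set R := `[n.+2%:R^-1, n.+2%:R]%classic.
pose G (n : nat) : set R := `[F n.+2%:R^-1, F n.+2%:R]%classic.
have n1 (n : nat) : (1 : R) < n.+2%:R by rewrite ltr1n.
have n0 (n : nat) : (0 : R) < n.+2%:R by rewrite ltr0n.
have nV0 (n : nat) : (0 : R) < n.+2%:R^-1 by rewrite invr_gt0.
have En n : n.+2%:R^-1 < n.+2%:R :> R.
  by rewrite (lt_trans _ (n1 n))// invf_lt1.
have cF (u : R) : 0 < u -> {for u, continuous F}.
  by move=> u0; have [+ _] := dF u u0 => /derivable1_diffP/differentiable_continuous.
have incF (x y : R) : 0 < x -> x < y -> F x < F y.
  move=> x0 xy; have [| |z] := @MVT _ F F' x y xy.
  - by move=> z; rewrite in_itv/= => /andP[xz _]; apply: dF; exact: lt_trans xz.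
  - apply: continuous_in_subspaceT => z /set_mem /=; rewrite in_itv/= => /andP[xz _].
    by apply: cF; exact: lt_le_trans xz.
  - rewrite in_itv/= => /andP[xz _] e; rewrite -subr_gt0 e mulr_gt0 ?subr_gt0//.
    by apply: F'0; exact: lt_trans xz.
have F_ge (x y : R) : 0 < x -> x <= y -> F x <= F y.
  by move=> x0; rewrite le_eqVlt => /predU1P[->//|xy]; apply: ltW; exact: incF.
have mE n : measurable (E n) by exact: measurable_itv.
have mG n : measurable (G n) by exact: measurable_itv.
have ED n : E n `<=` D.
  move=> x; rewrite /E /= !in_itv/= andbT => /andP[+ _].
  by apply: lt_le_trans.
have GD n : G n `<=` D.
  move=> x; rewrite /G /= !in_itv/= andbT => /andP[+ _].
  by apply: lt_le_trans; exact: F_gt0.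
have DE : D = \bigcup_n E n.
  apply/seteqP; split => [x|x [n _ /ED//]].
  rewrite /= in_itv/= andbT => x0; near \oo => n; exists n => //; rewrite /E /= in_itv/=.
  have xn : x <= n%:R by near: n; exact: nbhs_infty_ger.
  have xVn : x^-1 <= n%:R by near: n; exact: nbhs_infty_ger.
  have nn2 : (n%:R : R) <= n.+2%:R by rewrite ler_nat -addn2 leq_addr.
  rewrite (le_trans xn nn2) andbT invf_ple ?posrE//.
  exact: le_trans nn2.
have DG : D = \bigcup_n G n.
  apply/seteqP; split => [x|x [n _ /GD//]].
  rewrite /= in_itv/= andbT => x0; near \oo => n; exists n => //; rewrite /G /= in_itv/=.
  apply/andP; split; apply: ltW; near: n.
    have h : F n.+2%:R^-1 @[n --> \oo] --> (0 : R).
      apply: ((cvg_at_rightP F 0 0).1 F0 (fun n => n.+2%:R^-1)).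
      split; first by move=> n; rewrite invr_gt0.
      have := @cvg_harmonic R; rewrite -(cvg_shiftn 1) /=.
      by under eq_fun do rewrite addn1.
    by move/cvgr_lt : h; apply.
  have h : F n.+2%:R @[n --> \oo] --> +oo.
    apply: (cvg_comp (fun n : nat => n.+2%:R : R) F) Fy.
    have := @cvgr_idn R; rewrite -(cvg_shiftn 2) /=.
    by under eq_fun do rewrite addn2.
  by move/cvgryPgt : h; apply.
have ndE : {homo E : n m / (n <= m)%N >-> (n <= m)%O}.
  move=> n m nm; apply/subsetPset => x; rewrite /E /= !in_itv/= => /andP[h1 h2].
  apply/andP; split.
    by apply: le_trans h1; rewrite lef_pV2 ?posrE// ler_nat.
  by apply: le_trans h2 _; rewrite ler_nat.
have ndG : {homo G : n m / (n <= m)%N >-> (n <= m)%O}.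
  move=> n m nm; apply/subsetPset => x; rewrite /G /= !in_itv/= => /andP[h1 h2].
  apply/andP; split.
    by apply: le_trans h1; apply: F_ge => //; rewrite lef_pV2 ?posrE// ler_nat.
  by apply: le_trans h2 _; apply: F_ge => //; rewrite ler_nat.
have dFE (u : R) : 0 < u -> (F^`())%classic u = F' u.
  by move=> u0; rewrite derive1E; have [_] := dF u u0.
have cF1 (u : R) : 0 < u -> {for u, continuous (F^`())%classic}.
  move=> u0; rewrite /prop_for /continuous_at dFE//.
  apply: cvg_trans (cF' u u0); apply: near_eq_cvg; near=> x.
  by rewrite dFE//; near: x; exact: lt_nbhsr.
have EG n : (\int[mu]_(x in G n) (f x)%:E = \int[mu]_(x in E n) (f (F x) * F' x)%:E)%E.
  rewrite (integration_by_substitution_increasing (ltW (En n))).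
  - apply: eq_integral => x /set_mem /ED; rewrite /= in_itv/= andbT => x0.
    by rewrite !fctE dFE.
  - move=> x y; rewrite !in_itv/= => /andP[x1 _] _; apply: incF.
    exact: lt_le_trans x1.
  - move=> x; rewrite in_itv/= => /andP[x1 _]; apply: cF1.
    exact: lt_trans x1.
  - apply/cvg_ex; exists ((F^`())%classic n.+2%:R^-1); apply: cvg_at_right_filter.
    exact: cF1.
  - apply/cvg_ex; exists ((F^`())%classic n.+2%:R); apply: cvg_at_left_filter.
    exact: cF1.
  - split.
    + move=> x; rewrite in_itv/= => /andP[x1 _].
      by have [] := dF x (lt_trans (nV0 n) x1).
    + by apply: cvg_at_right_filter; exact: cF.
    + by apply: cvg_at_left_filter; exact: cF.
  - apply: continuous_in_subspaceT => x /set_mem /GD /=.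
    by rewrite in_itv/= andbT; exact: cf.
have mfF : measurable_fun D (fun x => f (F x) * F' x).
  apply: measurable_pos_continuous => u u0; apply: cvgM; last exact: cF'.
  apply: continuous_comp; [exact: cF|apply: cf; exact: F_gt0].
have mf : measurable_fun D f by exact: measurable_pos_continuous.
have cvE : (\int[mu]_(x in E n) (f (F x) * F' x)%:E)%E @[n --> \oo] -->
    (\int[mu]_(x in D) (f (F x) * F' x)%:E)%E.
  rewrite DE; apply: ge0_nondecreasing_set_cvg_integral => //.
  - by move=> n; apply/measurable_EFinP; apply: measurable_funS mfF.
  - move=> n x /ED; rewrite /= in_itv/= andbT => x0.
    by rewrite lee_fin mulr_ge0 ?f0 ?F_gt0// ltW// F'0.
have cvG : (\int[mu]_(x in G n) (f x)%:E)%E @[n --> \oo] -->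
    (\int[mu]_(x in D) (f x)%:E)%E.
  rewrite DG; apply: ge0_nondecreasing_set_cvg_integral => //.
  - by move=> n; apply/measurable_EFinP; apply: measurable_funS mf.
  - move=> n x /GD; rewrite /= in_itv/= andbT => x0.
    by rewrite lee_fin f0.
move: cvG; rewrite (funext EG) => cvG.
exact: (cvg_unique _ cvG cvE).
Unshelve. all: by end_near. Qed.

Lemma pos_scaling (c : R) (f : R -> R) : 0 < c ->
  (forall u : R, 0 < u -> {for u, continuous f}) ->
  (forall u : R, 0 < u -> 0 <= f u) ->
  (\int[mu]_(x in D) (f (c * x))%:E = c^-1%:E * \int[mu]_(x in D) (f x)%:E)%E.
Proof.
move=> c0 cf f0.
have dF (u : R) : is_derive u 1 (fun x => c * x) c.
  by apply: (is_derive_eq (is_deriveZ c (is_derive_id u 1))); rewrite /GRing.scale /= mulr1.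
rewrite [in RHS](pos_substitution (f := f) (F := fun x => c * x) (F' := fun=> c))//.
- rewrite -ge0_integralZl//=.
  + by apply: eq_integral => x _; rewrite -EFinM mulrCA mulVf ?mulr1 ?gt_eqF.
  + apply/measurable_EFinP; apply: measurable_pos_continuous => u u0.
    apply: cvgM; last exact: cvg_cst.
    apply: continuous_comp; last by apply: cf; rewrite mulr_gt0.
    by apply: cvgM; [exact: cvg_cst|exact: cvg_id].
  + move=> x; rewrite /= in_itv/= andbT => x0.
    by rewrite lee_fin mulr_ge0 ?f0 ?mulr_gt0// ltW.
  + by rewrite lee_fin invr_ge0 ltW.
- by move=> u u0; rewrite mulr_gt0.
- by move=> u _; exact: cvg_cst.
- apply: cvg_at_right_filter; rewrite -[X in _ --> X](mulr0 c).
  by apply: cvgM; [exact: cvg_cst|exact: cvg_id].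
- apply/cvgryPge => A; near=> x.
  have /ltW : A / c < x by near: x; apply: nbhs_pinfty_gt; rewrite num_real.
  by rewrite ler_pdivrMr// mulrC.
Unshelve. all: by end_near. Qed.

End PosSubstitution.

Section PosWrappers.
Variable R : realType.
Local Notation mu := (@lebesgue_measure R).
Local Notation D := (`]0, +oo[%classic : set R).
Implicit Types (f g : R -> R) (c : R).

Let mD : measurable D. Proof. exact: measurable_itv. Qed.

Lemma pos_integrableZ c f : mu.-integrable D (EFin \o f) ->
  mu.-integrable D (EFin \o (fun x => c * f x)).
Proof. by apply: integrable_cmul. Qed.

Lemma pos_integrableB f g : mu.-integrable D (EFin \o f) ->
  mu.-integrable D (EFin \o g) -> mu.-integrable D (EFin \o (fun x => f x - g x)).
Proof.
move=> jf jg; have : mu.-integrable D (fun x => (f x)%:E - (g x)%:E)%E by apply: integrableB.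
by congr (is_true (integrable _ _ _)); apply/funext => x /=; rewrite EFinB.
Qed.

Lemma pos_integrableD f g : mu.-integrable D (EFin \o f) ->
  mu.-integrable D (EFin \o g) -> mu.-integrable D (EFin \o (fun x => f x + g x)).
Proof.
move=> jf jg; have : mu.-integrable D (fun x => (f x)%:E + (g x)%:E)%E by apply: integrableD.
by congr (is_true (integrable _ _ _)); apply/funext => x /=; rewrite EFinD.
Qed.

Lemma pos_RintegralD f g : mu.-integrable D (EFin \o f) ->
  mu.-integrable D (EFin \o g) ->
  \int[mu]_(x in D) (f x + g x) = \int[mu]_(x in D) f x + \int[mu]_(x in D) g x.
Proof. by move=> jf jg; apply: RintegralD. Qed.

Lemma pos_integrable_norm f : mu.-integrable D (EFin \o f) ->
  mu.-integrable D (EFin \o (fun x => `|f x|)).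
Proof. by move=> jf; apply: integrable_norm. Qed.

Lemma eq_pos_integrable f g : (forall u : R, 0 < u -> f u = g u) ->
  mu.-integrable D (EFin \o f) -> mu.-integrable D (EFin \o g).
Proof.
move=> fg; apply: eq_integrable => // u; rewrite inE /= in_itv/= andbT => u0.
by rewrite fg.
Qed.

Lemma pos_RintegralZ c f : mu.-integrable D (EFin \o f) ->
  \int[mu]_(x in D) (c * f x) = c * \int[mu]_(x in D) f x.
Proof. by move=> jf; apply: RintegralZl. Qed.

Lemma pos_RintegralB f g : mu.-integrable D (EFin \o f) ->
  mu.-integrable D (EFin \o g) ->
  \int[mu]_(x in D) (f x - g x) = \int[mu]_(x in D) f x - \int[mu]_(x in D) g x.
Proof. by move=> jf jg; apply: RintegralB. Qed.

Lemma eq_pos_Rintegral f g : (forall u : R, 0 < u -> f u = g u) ->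
  \int[mu]_(x in D) f x = \int[mu]_(x in D) g x.
Proof.
move=> fg; apply: eq_Rintegral => u /set_mem; rewrite /= in_itv/= andbT.
exact: fg.
Qed.

Lemma le_pos_Rintegral f g : mu.-integrable D (EFin \o f) ->
  mu.-integrable D (EFin \o g) -> (forall u : R, 0 < u -> f u <= g u) ->
  \int[mu]_(x in D) f x <= \int[mu]_(x in D) g x.
Proof.
move=> jf jg fg; apply: le_Rintegral => // u /=; rewrite in_itv/= andbT.
exact: fg.
Qed.

Lemma pos_scalingR c f : 0 < c ->
  (forall u : R, 0 < u -> {for u, continuous f}) ->
  (forall u : R, 0 < u -> 0 <= f u) -> mu.-integrable D (EFin \o f) ->
  \int[mu]_(x in D) f (c * x) = c^-1 * \int[mu]_(x in D) f x.
Proof.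
move=> c0 cf f0 jf; rewrite /Rintegral pos_scaling// fineM//.
exact: integrable_fin_num.
Qed.

Lemma pos_EFin_Rintegral f : mu.-integrable D (EFin \o f) ->
  (\int[mu]_(x in D) (f x)%:E = (\int[mu]_(x in D) f x)%:E)%E.
Proof.
by move=> jf; rewrite /Rintegral fineK//; exact: integrable_fin_num.
Qed.

Lemma pos_integrable_scaling c f : 0 < c ->
  (forall u : R, 0 < u -> {for u, continuous f}) ->
  (forall u : R, 0 < u -> 0 <= f u) -> mu.-integrable D (EFin \o f) ->
  mu.-integrable D (EFin \o (fun x => f (c * x))).
Proof.
move=> c0 cf f0 jf.
apply: (@integrable_ge0_fin _ _ _ (c^-1 * \int[mu]_(x in D) f x)) => //.
- apply: measurable_pos_continuous => u u0.
  apply: (cvg_comp (fun x => c * x) f); last by apply: cf; rewrite mulr_gt0.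
  by apply: cvgM; [exact: cvg_cst|exact: cvg_id].
- by move=> u /=; rewrite in_itv/= andbT => u0; rewrite f0// mulr_gt0.
- by rewrite pos_scaling// pos_EFin_Rintegral.
Qed.

End PosWrappers.

(** * Cauchy-Riemann equations in polar coordinates *)

Section PolarDerivative.
Variable R : realType.
Implicit Types (F G : R -> R -> R[i]) (u v : R) (x y z : R[i]).

(** Kept next to [normc] because it is polynomial in the two components. *)
Definition sqnormc z : R := complex.Re z ^+ 2 + complex.Im z ^+ 2.

Lemma ReD x y : complex.Re (x + y) = complex.Re x + complex.Re y.
Proof. by case: x y => [? ?] [? ?]. Qed.

Lemma ImD x y : complex.Im (x + y) = complex.Im x + complex.Im y.
Proof. by case: x y => [? ?] [? ?]. Qed.

Lemma ReM x y :
  complex.Re (x * y) = complex.Re x * complex.Re y - complex.Im x * complex.Im y.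
Proof. by case: x y => [? ?] [? ?]. Qed.

Lemma ImM x y :
  complex.Im (x * y) = complex.Re x * complex.Im y + complex.Im x * complex.Re y.
Proof. by case: x y => [? ?] [? ?]. Qed.

Lemma ReV z : complex.Re z^-1 = complex.Re z * (sqnormc z)^-1.
Proof. by case: z. Qed.

Lemma ImV z : complex.Im z^-1 = - complex.Im z * (sqnormc z)^-1.
Proof. by case: z => [? ?]; rewrite /= mulNr. Qed.

Lemma sqnormc_eq0 z : (sqnormc z == 0) = (z == 0).
Proof.
case: z => x y; rewrite eq_complex /sqnormc /=.
by rewrite paddr_eq0 ?sqr_ge0// !sqrf_eq0.
Qed.

(** In polar coordinates z = u e^(i v) the Cauchy-Riemann equations say that
u dF/du and dF/dv differ by the factor i.  Here [g] is the value of z F'(z), in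
which both partial derivatives are expressed. *)
Definition polar_derive F (g : R[i]) u v : Prop :=
  [/\ is_derive u 1 (fun u => complex.Re (F u v)) (complex.Re g / u),
      is_derive u 1 (fun u => complex.Im (F u v)) (complex.Im g / u),
      is_derive v 1 (fun v => complex.Re (F u v)) (- complex.Im g) &
      is_derive v 1 (fun v => complex.Im (F u v)) (complex.Re g)].

Lemma polar_derive_eq F g g' u v : polar_derive F g u v -> g = g' -> polar_derive F g' u v.
Proof. by move=> + <-. Qed.

Lemma polar_derive_cst (c : R[i]) u v : polar_derive (fun _ _ => c) 0 u v.
Proof.
by split; apply: (is_derive_eq (is_derive_cst _ _ _)); rewrite /= ?mul0r ?oppr0.
Qed.

Lemma polar_deriveD F G f g u v : polar_derive F f u v -> polar_derive G g u v ->
  polar_derive (fun u v => F u v + G u v) (f + g) u v.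
Proof.
move=> [F1 F2 F3 F4] [G1 G2 G3 G4]; split.
- under eq_fun do rewrite ReD.
  by apply: (is_derive_eq (is_deriveD F1 G1)); rewrite ReD mulrDl.
- under eq_fun do rewrite ImD.
  by apply: (is_derive_eq (is_deriveD F2 G2)); rewrite ImD mulrDl.
- under eq_fun do rewrite ReD.
  by apply: (is_derive_eq (is_deriveD F3 G3)); rewrite ImD opprD.
- under eq_fun do rewrite ImD.
  by apply: (is_derive_eq (is_deriveD F4 G4)); rewrite ReD.
Qed.

Lemma polar_deriveM F G f g u v : polar_derive F f u v -> polar_derive G g u v ->
  polar_derive (fun u v => F u v * G u v) (f * G u v + F u v * g) u v.
Proof.
move=> [F1 F2 F3 F4] [G1 G2 G3 G4]; split.
- under eq_fun do rewrite ReM.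
  apply: (is_derive_eq (is_deriveB (is_deriveM F1 G1) (is_deriveM F2 G2))).
  by rewrite ReD !ReM /GRing.scale /=; ring.
- under eq_fun do rewrite ImM.
  apply: (is_derive_eq (is_deriveD (is_deriveM F1 G2) (is_deriveM F2 G1))).
  by rewrite ImD !ImM /GRing.scale /=; ring.
- under eq_fun do rewrite ReM.
  apply: (is_derive_eq (is_deriveB (is_deriveM F3 G3) (is_deriveM F4 G4))).
  by rewrite ImD !ImM /GRing.scale /=; ring.
- under eq_fun do rewrite ImM.
  apply: (is_derive_eq (is_deriveD (is_deriveM F3 G4) (is_deriveM F4 G3))).
  by rewrite ReD !ReM /GRing.scale /=; ring.
Qed.

Lemma polar_deriveB F G f g u v : polar_derive F f u v -> polar_derive G g u v ->
  polar_derive (fun u v => F u v - G u v) (f - g) u v.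
Proof.
move=> pF pG; have := polar_deriveD pF (polar_deriveM (polar_derive_cst (-1) u v) pG).
rewrite (_ : (fun u v => F u v + -1 * G u v) = (fun u v => F u v - G u v)).
  by move=> /polar_derive_eq; apply; ring.
by apply/funext => ?; apply/funext => ?; rewrite mulN1r.
Qed.

Lemma polar_deriveV F f u v : F u v != 0 -> polar_derive F f u v ->
  polar_derive (fun u v => (F u v)^-1) (- (F u v)^-2 * f) u v.
Proof.
move=> F0 [F1 F2 F3 F4].
have n0 : sqnormc (F u v) != 0 by rewrite sqnormc_eq0.
have E (z w : R[i]) : sqnormc z != 0 -> complex.Re (- z ^- 2 * w) =
    - ((complex.Re z ^+ 2 - complex.Im z ^+ 2) * complex.Re w +
     2 * complex.Re z * complex.Im z * complex.Im w) / (sqnormc z) ^+ 2 /\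
    complex.Im (- z ^- 2 * w) =
    - ((complex.Re z ^+ 2 - complex.Im z ^+ 2) * complex.Im w -
     2 * complex.Re z * complex.Im z * complex.Re w) / (sqnormc z) ^+ 2.
  rewrite /sqnormc; case: z w => x y [z t] /= z0.
  have n1 : (x * x - y * y) ^+ 2 + (x * y + y * x) ^+ 2 = (x ^+ 2 + y ^+ 2) ^+ 2.
    by ring.
  by split; rewrite n1; field.
have [E1 E2] := E _ f n0.
have V1 : is_derive u 1 (fun u => (sqnormc (F u v))^-1) (- (sqnormc (F u v)) ^- 2 *:
    ((2 * complex.Re (F u v)) *: (complex.Re f / u) +
     (2 * complex.Im (F u v)) *: (complex.Im f / u))).
  apply: is_deriveV => //.
  exact: (is_derive_eq (is_deriveD (is_deriveX 2 F1) (is_deriveX 2 F2))).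
have V3 : is_derive v 1 (fun v => (sqnormc (F u v))^-1) (- (sqnormc (F u v)) ^- 2 *:
    ((2 * complex.Re (F u v)) *: (- complex.Im f) +
     (2 * complex.Im (F u v)) *: (complex.Re f))).
  apply: is_deriveV => //.
  exact: (is_derive_eq (is_deriveD (is_deriveX 2 F3) (is_deriveX 2 F4))).
split.
- under eq_fun do rewrite ReV.
  apply: (is_derive_eq (is_deriveM F1 V1)).
  by move: n0; rewrite E1 /sqnormc /GRing.scale /=; move: (u^-1) => w n0; field.
- under eq_fun do rewrite ImV mulNr.
  apply: (is_derive_eq (is_deriveN (is_deriveM F2 V1))).
  by move: n0; rewrite E2 /sqnormc /GRing.scale /=; move: (u^-1) => w n0; field.
- under eq_fun do rewrite ReV.
  apply: (is_derive_eq (is_deriveM F3 V3)).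
  by move: n0; rewrite E2 /sqnormc /GRing.scale /=; move: (u^-1) => w n0; field.
- under eq_fun do rewrite ImV mulNr.
  apply: (is_derive_eq (is_deriveN (is_deriveM F4 V3))).
  by move: n0; rewrite E1 /sqnormc /GRing.scale /=; move: (u^-1) => w n0; field.
Qed.

(** The branch of z^p at z = u e^(i v) given by the angle v. *)
Definition cpow (p u v : R) : R[i] := Complex (u `^ p * cos (p * v)) (u `^ p * sin (p * v)).

Lemma polar_derive_cpow p u v : 0 < u -> polar_derive (cpow p) (Complex p 0 * cpow p u v) u v.
Proof.
move=> u0.
have P : is_derive u 1 (fun u => u `^ p) (p * u `^ p / u).
  apply: (is_derive_eq (is_derive1_powR p u0)).
  rewrite powRB; last by rewrite (gt_eqF u0) implybT.
  by rewrite powRr1 ?ltW// mulrA.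
have A : is_derive v 1 (fun v => p * v) p.
  by apply: (is_derive_eq (is_deriveZ p (is_derive_id v 1))); rewrite /GRing.scale /= mulr1.
split; rewrite /cpow /=.
- have := is_deriveM P (is_derive_cst (cos (p * v)) u 1).
  move/is_derive_eq; apply; rewrite /GRing.scale /=; field.
  by rewrite gt_eqF.
- have := is_deriveM P (is_derive_cst (sin (p * v)) u 1).
  move/is_derive_eq; apply; rewrite /GRing.scale /=; field.
  by rewrite gt_eqF.
- have := is_deriveM (is_derive_cst (u `^ p) v 1) (is_derive1_comp (is_derive_cos (p * v)) A).
  by move/is_derive_eq; apply; rewrite /GRing.scale /=; ring.
- have := is_deriveM (is_derive_cst (u `^ p) v 1) (is_derive1_comp (is_derive_sin (p * v)) A).
  by move/is_derive_eq; apply; rewrite /GRing.scale /=; ring.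
Qed.

End PolarDerivative.

(** * The integrand on a ray *)

Import ComplexField.Normc.

Section ComplexNorm.
Variable R : realType.
Implicit Types (z : R[i]) (u v p : R).

Lemma normc_sqrt z : normc z = Num.sqrt (sqnormc z).
Proof. by case: z. Qed.

Lemma normc_ge0 z : 0 <= normc z.
Proof. by rewrite normc_sqrt sqrtr_ge0. Qed.

Lemma ler_Re_normc z : `|complex.Re z| <= normc z.
Proof. by rewrite normc_sqrt -sqrtr_sqr ler_wsqrtr// lerDl sqr_ge0. Qed.

Lemma ler_Im_normc z : `|complex.Im z| <= normc z.
Proof. by rewrite normc_sqrt -sqrtr_sqr ler_wsqrtr// lerDr sqr_ge0. Qed.

Lemma ler_normcD (x y : R[i]) : normc (x + y) <= normc x + normc y.
Proof. exact: le_normcD. Qed.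

Lemma normcNE (x : R[i]) : normc (- x) = normc x.
Proof. exact: normcN. Qed.

Lemma normcR p : normc (Complex p 0) = `|p|.
Proof. by rewrite /= expr0n /= addr0 sqrtr_sqr. Qed.

Lemma normc_cpow p u v : normc (cpow p u v) = u `^ p.
Proof.
rewrite normc_sqrt /sqnormc /cpow /= !exprMn -mulrDr cos2Dsin2 mulr1 sqrtr_sqr.
by rewrite ger0_norm// powR_ge0.
Qed.

Lemma sqnormc_1Dpolar (X t : R) :
  sqnormc (Complex (1 + X * cos t) (X * sin t)) = 1 + 2 * X * cos t + X ^+ 2.
Proof.
rewrite /sqnormc /=.
have -> : (1 + X * cos t) ^+ 2 + (X * sin t) ^+ 2 =
  1 + 2 * X * cos t + X ^+ 2 * (cos t ^+ 2 + sin t ^+ 2) by ring.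
by rewrite cos2Dsin2 mulr1.
Qed.

(** The squared modulus 1 + 2 X cos t + X^2 exceeds (1 + k) / 2 times (1 + X)^2 by
a nonnegative multiple of (1 - X)^2. *)
Lemma normc_1Dpolar_ge (X t k : R) : 0 <= X -> k <= cos t -> -1 <= k ->
  Num.sqrt ((1 + k) / 2) * (1 + X) <= normc (Complex (1 + X * cos t) (X * sin t)).
Proof.
move=> X0 kt k1.
have ct1 := cos_le1 t.
rewrite normc_sqrt sqnormc_1Dpolar -[X in _ * X]ger0_norm ?addr_ge0//.
rewrite -sqrtr_sqr -sqrtrM; last by rewrite divr_ge0// -lerBlDl sub0r.
by apply: ler_wsqrtr; have := sqr_ge0 (1 - X); nra.
Qed.

End ComplexNorm.

Section RayIntegrand.
Variables (R : realType) (b l : R).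
Hypotheses (b1 : 1 < b) (l0 : 0 < l).
Implicit Types u v : R.

Definition rayN u v : R[i] := 1 - cpow 1 u v.
Definition rayA u v : R[i] := (1 + Complex l 0 * cpow 1 u v)^-1.
Definition rayB u v : R[i] := (1 - cpow b u v)^-1.
(** The function P(z) = z (1 - z) / ((1 + l z) (1 - z^b)) at z = u e^(i v). *)
Definition rayP u v : R[i] := cpow 1 u v * rayN u v * rayA u v * rayB u v.
(** The function z P'(z), from the product rule. *)
Definition rayP' u v : R[i] :=
  cpow 1 u v * rayN u v * rayA u v * rayB u v
  - cpow 1 u v * cpow 1 u v * rayA u v * rayB u v
  - cpow 1 u v * rayN u v * (rayA u v * rayA u v * (Complex l 0 * cpow 1 u v)) * rayB u v
  + cpow 1 u v * rayN u v * rayA u v * (rayB u v * rayB u v * (Complex b 0 * cpow b u v)).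

Definition ray_regular u v := [/\ 0 < u, 1 + Complex l 0 * cpow 1 u v != 0 & 1 - cpow b u v != 0].

Let pcpow1 u v : 0 < u -> polar_derive (cpow 1) (cpow 1 u v) u v.
Proof. by move=> u0; apply: polar_derive_eq (polar_derive_cpow 1 v u0) _; rewrite mul1r. Qed.

Lemma polar_derive_rayN u v : 0 < u -> polar_derive rayN (- cpow 1 u v) u v.
Proof.
move=> u0; have := polar_deriveB (polar_derive_cst 1 u v) (pcpow1 v u0).
by move=> /polar_derive_eq; apply; rewrite sub0r.
Qed.

Lemma polar_derive_rayA u v : ray_regular u v ->
  polar_derive rayA (- (rayA u v * rayA u v * (Complex l 0 * cpow 1 u v))) u v.
Proof.
move=> [u0 A0 _].
have := polar_deriveV A0 (polar_deriveD (polar_derive_cst 1 u v)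
  (polar_deriveM (polar_derive_cst (Complex l 0) u v) (pcpow1 v u0))).
by move=> /polar_derive_eq; apply; rewrite /rayA; field.
Qed.

Lemma polar_derive_rayB u v : ray_regular u v ->
  polar_derive rayB (rayB u v * rayB u v * (Complex b 0 * cpow b u v)) u v.
Proof.
move=> [u0 _ B0].
have := polar_deriveV B0 (polar_deriveB (polar_derive_cst 1 u v) (polar_derive_cpow b v u0)).
by move=> /polar_derive_eq; apply; rewrite /rayB; field.
Qed.

Lemma polar_derive_rayP u v : ray_regular u v -> polar_derive rayP (rayP' u v) u v.
Proof.
move=> r; have u0 : 0 < u by case: r.
have := polar_deriveM (polar_deriveM (polar_deriveM (pcpow1 v u0) (polar_derive_rayN v u0))
  (polar_derive_rayA r)) (polar_derive_rayB r).
by move=> /polar_derive_eq; apply; rewrite /rayP'; ring.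
Qed.

Lemma polar_derive_rayP' u v : ray_regular u v -> exists g, polar_derive rayP' g u v.
Proof.
move=> r; have u0 : 0 < u by case: r.
have hz := pcpow1 v u0; have hN := polar_derive_rayN v u0.
have hA := polar_derive_rayA r; have hB := polar_derive_rayB r.
have hl := polar_deriveM (polar_derive_cst (Complex l 0) u v) hz.
have hb := polar_deriveM (polar_derive_cst (Complex b 0) u v) (polar_derive_cpow b v u0).
eexists; rewrite /rayP'; apply: polar_deriveD; last first.
  exact: polar_deriveM (polar_deriveM (polar_deriveM hz hN) hA)
    (polar_deriveM (polar_deriveM hB hB) hb).
apply: polar_deriveB;
  last exact: polar_deriveM (polar_deriveM (polar_deriveM hz hN)
    (polar_deriveM (polar_deriveM hA hA) hl)) hB.
apply: polar_deriveB; last exact: polar_deriveM (polar_deriveM (polar_deriveM hz hz) hA) hB.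
exact: polar_deriveM (polar_deriveM (polar_deriveM hz hN) hA) hB.
Qed.

Lemma rayA_den_ge k u v : 0 < u -> k <= cos v -> -1 <= k ->
  Num.sqrt ((1 + k) / 2) * (1 + l * u) <= normc (1 + Complex l 0 * cpow 1 u v).
Proof.
move=> u0 kv k1.
have -> : 1 + Complex l 0 * cpow 1 u v =
    Complex (1 + (l * u) * cos v) ((l * u) * sin v).
  rewrite /cpow powRr1 ?ltW// mul1r; apply/eqP; rewrite eq_complex /=.
  by rewrite !mul0r; apply/andP; split; apply/eqP; ring.
by apply: normc_1Dpolar_ge => //; rewrite mulr_ge0// ltW.
Qed.

(** The poles of P are at angle pi (from 1 + l z) and at the zeros of 1 - z^b.
Keeping cos v away from -1 and cos (b v) away from 1 keeps the ray away from
both. *)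
Lemma ray_bound (c0 c1 : R) : -1 < c0 -> c1 < 1 ->
  exists2 C, 0 < C & forall u v, 0 < u -> c0 <= cos v -> cos (b * v) <= c1 ->
   [/\ ray_regular u v,
       normc (rayP u v) <= C * (u / (1 + u `^ b)) &
       normc (rayP' u v) <= C * (u / (1 + u `^ b))].
Proof.
move=> c01 c11.
pose k0 := Num.sqrt ((1 + c0) / 2); pose k1 := Num.sqrt ((1 - c1) / 2).
have k00 : 0 < k0 by rewrite sqrtr_gt0; lra.
have k10 : 0 < k1 by rewrite sqrtr_gt0; lra.
pose m := 1 + l^-1; have m0 : 0 < m by rewrite addr_gt0// invr_gt0.
pose C1 := m * k0^-1 * k1^-1.
have C10 : 0 < C1 by rewrite !mulr_gt0// invr_gt0.
exists (C1 * (2 + k0^-1 + b * k1^-1)).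
  by rewrite mulr_gt0// !addr_gt0 ?mulr_gt0 ?invr_gt0// (lt_trans ltr01).
move=> u v u0 cv cbv.
have X0 : 0 < u `^ b by rewrite powR_gt0.
have A_ge : k0 * (1 + l * u) <= normc (1 + Complex l 0 * cpow 1 u v).
  by apply: rayA_den_ge => //; exact: ltW.
have B_ge : k1 * (1 + u `^ b) <= normc (1 - cpow b u v).
  have -> : 1 - cpow b u v =
      Complex (1 + (u `^ b) * cos (b * v + pi)) ((u `^ b) * sin (b * v + pi)).
    rewrite /cpow sinDpi cosDpi; apply/eqP; rewrite eq_complex /=.
    by apply/andP; split; apply/eqP; ring.
  apply: normc_1Dpolar_ge; [exact: ltW|rewrite cosDpi; lra|lra].
have lu0 : 0 < 1 + l * u by rewrite addr_gt0// mulr_gt0.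
have X1 : 0 < 1 + u `^ b by rewrite addr_gt0.
have nz z : 0 < normc z -> z != 0 by apply: contraTneq => ->; rewrite normc0 ltxx.
have nA0 := lt_le_trans (mulr_gt0 k00 lu0) A_ge.
have nB0 := lt_le_trans (mulr_gt0 k10 X1) B_ge.
set al := normc (rayA u v); set be := normc (rayB u v); set n := normc (rayN u v).
have al0 : 0 <= al := normc_ge0 _.
have be0 : 0 <= be := normc_ge0 _.
have n0 : 0 <= n := normc_ge0 _.
have al_le : al * (1 + l * u) <= k0^-1.
  rewrite /al /rayA normcV -ler_pdivlMr// -invfM lef_pV2 ?posrE ?mulr_gt0//.
have be_le : be * (1 + u `^ b) <= k1^-1.
  rewrite /be /rayB normcV -ler_pdivlMr// -invfM lef_pV2 ?posrE ?mulr_gt0//.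
have n_le : n <= 1 + u.
  have := ler_normcD 1 (- cpow 1 u v).
  by rewrite normcNE normc1 normc_cpow powRr1 ?(ltW u0).
have um : 1 + u <= m * (1 + l * u).
  rewrite /m mulrDl mul1r mulrDr mulr1 mulKf ?gt_eqF//.
  have : 0 < l * u by rewrite mulr_gt0.
  have : 0 < l^-1 by rewrite invr_gt0.
  lra.
have T w : 0 <= w -> w <= 1 + u -> w * al * be <= C1 / (1 + u `^ b).
  move=> w0 wu; rewrite ler_pdivlMr// /C1 -(mulrA (w * al)).
  apply: ler_pM => //; [exact: mulr_ge0|by rewrite mulr_ge0// ltW|].
  apply: (@le_trans _ _ (m * (1 + l * u) * al)).
    by apply: ler_wpM2r => //; exact: le_trans um.
  by rewrite -mulrA ler_pM2l// mulrC.
have z_eq : normc (cpow 1 u v) = u by rewrite normc_cpow powRr1 ?ltW.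
have TN := T _ n0 n_le.
have Tu : u * al * be <= C1 / (1 + u `^ b) by apply: T; lra.
have lual : l * u * al <= k0^-1 by nra.
have bXbe : b * u `^ b * be <= b * k1^-1.
  rewrite -mulrA ler_pM2l ?(lt_trans ltr01)//; nra.
have bk : 0 < b * k1^-1 by rewrite mulr_gt0 ?invr_gt0// (lt_trans ltr01).
have k0V : 0 < k0^-1 by rewrite invr_gt0.
have CX : 0 < C1 / (1 + u `^ b) by rewrite divr_gt0.
split; first by split => //; exact: nz.
- rewrite /rayP !normcM z_eq -/n -/al -/be.
  apply: (@le_trans _ _ (u * (C1 / (1 + u `^ b)))).
    by move: TN; rewrite -(ler_pM2l u0) !mulrA.
  rewrite [leRHS](_ : _ = (2 + k0^-1 + b * k1^-1) * (u * (C1 / (1 + u `^ b)))); last by ring.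
  apply: ler_peMl; [by rewrite mulr_ge0// ltW|lra].
- rewrite /rayP'.
  apply: le_trans (ler_normcD _ _) _.
  apply: le_trans (lerD (ler_normcD _ _) (lexx _)) _.
  apply: le_trans (lerD (lerD (ler_normcD _ _) (lexx _)) (lexx _)) _.
  rewrite !normcNE !normcM !normcR z_eq normc_cpow -/n -/al -/be.
  rewrite (gtr0_norm l0) (gtr0_norm (lt_trans ltr01 b1)).
  set K := C1 / (1 + u `^ b) in TN Tu CX *.
  have e1 : u * n * al * be <= u * K by move: TN; rewrite -(ler_pM2l u0) !mulrA.
  have e2 : u * u * al * be <= u * K by move: Tu; rewrite -(ler_pM2l u0) !mulrA.
  have e3 : u * n * (al * al * (l * u)) * be <= u * K * k0^-1.
    rewrite [leLHS](_ : _ = (u * n * al * be) * (l * u * al)); last by ring.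
    by rewrite ler_pM// ?mulr_ge0// ltW.
  have e4 : u * n * al * (be * be * (b * u `^ b)) <= u * K * (b * k1^-1).
    rewrite [leLHS](_ : _ = (u * n * al * be) * (b * u `^ b * be)); last by ring.
    by rewrite ler_pM// ?mulr_ge0// ltW// (lt_trans ltr01).
  rewrite [leRHS](_ : _ = u * K + u * K + u * K * k0^-1 + u * K * (b * k1^-1)).
    exact: lerD (lerD (lerD e1 e2) e3) e4.
  by rewrite /K; ring.
Qed.

End RayIntegrand.

(** * Rotation of the ray *)

Section RayRotation.
Variables (R : realType) (b l : R).
Hypotheses (b1 : 1 < b) (l0 : 0 < l).
Local Notation mu := (@lebesgue_measure R).
Local Notation D := (`]0, +oo[%classic : set R).
Local Notation P := (rayP b l).
Local Notation P' := (rayP' b l).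
Implicit Types u v : R.

Let b0 : 0 < b. Proof. exact: lt_trans b1. Qed.

Lemma cos_lt1 (t : R) : 0 < t < pi *+ 2 -> cos t < 1.
Proof.
move=> /andP[t0 t2]; have -> : t = (t / 2) *+ 2 by rewrite mulr2n -splitr.
rewrite cos_mulr2n cos2sin2.
have : 0 < sin (t / 2) by apply: sin_gt0_pi; rewrite mulr2n in t2; lra.
move=> s0; rewrite mulr2n; nra.
Qed.

(** The angles v with 0 < v < pi and 0 < b v < 2 pi avoid all the poles; the bound
is uniform on a segment of such angles because cosine attains its maximum. *)
Lemma ray_local_bound v1 v2 : 0 < v1 -> v1 <= v2 -> v2 < pi -> b * v2 < pi *+ 2 ->
  exists2 C, 0 < C & forall u v, 0 < u -> v1 <= v <= v2 ->
   [/\ ray_regular b l u v, normc (P u v) <= C * (u / (1 + u `^ b)) &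
       normc (P' u v) <= C * (u / (1 + u `^ b))].
Proof.
move=> v10 v12 v2pi bv2.
have c0 : -1 < cos v2.
  by rewrite -cospi ltr_cos// in_itv/= ?pi_ge0 ?lexx//; apply/andP; split; lra.
have [w wv wmax] : exists2 w, w \in `[v1, v2]%R & forall t, t \in `[v1, v2]%R ->
    cos (b * t) <= cos (b * w).
  apply: EVT_max => //; apply: continuous_subspaceT => x.
  apply: continuous_comp; last exact: continuous_cos.
  by apply: cvgM; [exact: cvg_cst|exact: cvg_id].
move: wv; rewrite in_itv/= => /andP[w1 w2].
have c1 : cos (b * w) < 1.
  apply: cos_lt1; rewrite mulr_gt0//=; last exact: lt_le_trans w1.
  by rewrite (le_lt_trans _ bv2)// ler_pM2l.
have [C C0 HC] := ray_bound b1 l0 c0 c1.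
exists C => // u v u0 /andP[vv1 vv2]; apply: HC => //.
- by rewrite leNgt ltr_cos ?in_itv/= -?leNgt//; apply/andP; split; lra.
- by apply: wmax; rewrite in_itv/= vv1.
Qed.

Lemma continuous_Re (F : R -> R -> R[i]) g u v : 0 < u -> polar_derive F g u v ->
  {for u, continuous (fun u => complex.Re (F u v))}.
Proof. by move=> u0 [[+ _] _ _ _] => /derivable1_diffP/differentiable_continuous. Qed.

Lemma continuous_Im (F : R -> R -> R[i]) g u v : 0 < u -> polar_derive F g u v ->
  {for u, continuous (fun u => complex.Im (F u v))}.
Proof. by move=> u0 [_ [+ _] _ _] => /derivable1_diffP/differentiable_continuous. Qed.

Lemma continuous_divu (f : R -> R) u : 0 < u -> {for u, continuous f} ->
  {for u, continuous (fun u => f u / u)}.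
Proof.
move=> u0 cf; apply: cvgM => //; apply: cvgV; last exact: cvg_id.
by rewrite gt_eqF.
Qed.

(** The imaginary part of the integral of P(z) dz / z along the ray. *)
Definition ray_integral v := \int[mu]_(u in D) (complex.Im (P u v) / u).

Lemma ray_bound_divu C u (z : R) : 0 < u -> `|z| <= C * (u / (1 + u `^ b)) ->
  `|z / u| <= C * (1 + u `^ b)^-1.
Proof.
move=> u0 zC; rewrite normrM normfV (gtr0_norm u0) ler_pdivrMr//.
by rewrite -mulrA (mulrC _^-1).
Qed.

Lemma integrable_ray_envelope C : mu.-integrable D (EFin \o (fun u => C * (1 + u `^ b)^-1)).
Proof.
by apply: integrable_cmul; [exact: measurable_itv|exact: integrable_oneDpowRV].
Qed.

Lemma ray_integrable v : 0 < v -> v < pi -> b * v < pi *+ 2 ->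
  mu.-integrable D (EFin \o (fun u => complex.Im (P u v) / u)).
Proof.
move=> v0 vpi bv; have [C C0 HC] := ray_local_bound v0 (lexx v) vpi bv.
have vv : v <= v <= v by rewrite lexx.
apply: (integrable_pos_le _ (integrable_ray_envelope C)).
  apply: measurable_pos_continuous => u u0; apply: continuous_divu => //.
  have [reg _ _] := HC u v u0 vv.
  exact: continuous_Im (polar_derive_rayP reg).
move=> u u0; have [_ h _] := HC u v u0 vv.
by apply: ray_bound_divu => //; exact: le_trans (ler_Im_normc _) h.
Qed.

(** The real part of z P'(z) / u is the derivative in u of the real part of P, which
vanishes at both ends of the ray. *)
Lemma ray_integral_deriv_zero v : 0 < v -> v < pi -> b * v < pi *+ 2 ->
  \int[mu]_(u in D) (complex.Re (P' u v) / u) = 0.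
Proof.
move=> v0 vpi bv; have [C C0 HC] := ray_local_bound v0 (lexx v) vpi bv.
have vv : v <= v <= v by rewrite lexx.
have cf u : 0 < u -> {for u, continuous (fun u => complex.Re (P' u v) / u)}.
  move=> u0; apply: continuous_divu => //.
  have [reg _ _] := HC u v u0 vv; have [g pg] := polar_derive_rayP' reg.
  exact: continuous_Re pg.
apply: (Rintegral_derive_pos0 (F := fun u => complex.Re (P u v))) => //.
- by move=> u u0; have [reg _ _] := HC u v u0 vv; have [] := polar_derive_rayP reg.
- apply: (integrable_pos_le _ (integrable_ray_envelope C)); first exact: measurable_pos_continuous.
  move=> u u0; have [_ _ h] := HC u v u0 vv.
  by apply: ray_bound_divu => //; exact: le_trans (ler_Re_normc _) h.
- apply: norm_cvg0; apply: (@squeeze_cvgr _ _ _ _ (cst 0) (fun u => C * u)).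
  + near=> u; have u0 : 0 < u by near: u; exact: nbhs_right_gt.
    have [_ h _] := HC u v u0 vv; rewrite normr_ge0 (le_trans (ler_Re_normc _))//.
    rewrite (le_trans h)// ler_pM2l// ler_pdivrMr; last by rewrite ltr_pwDl// powR_ge0.
    by rewrite ler_peMr ?(ltW u0)// lerDl powR_ge0.
  + exact: cvg_cst.
  + apply: cvg_at_right_filter; rewrite -[X in _ --> X](mulr0 C).
    by apply: cvgM; [exact: cvg_cst|exact: cvg_id].
- apply: norm_cvg0; apply: (@squeeze_cvgr _ _ _ _ (cst 0) (fun u => C * u `^ (- (b - 1)))).
  + near=> u; have u0 : 0 < u by near: u; exact: nbhs_pinfty_gt.
    have [_ h _] := HC u v u0 vv; rewrite normr_ge0 (le_trans (ler_Re_normc _))//.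
    rewrite (le_trans h)// ler_pM2l// opprB powRB; last by rewrite (gt_eqF u0) implybT.
    rewrite powRr1 ?(ltW u0)// ler_pM2l// lef_pV2 ?posrE ?powR_gt0 ?lerDr//.
    by rewrite ltr_pwDl// powR_ge0.
  + exact: cvg_cst.
  + rewrite -[X in _ --> X](mulr0 C); apply: cvgM; first exact: cvg_cst.
    by apply: cvgy_powRN; rewrite subr_gt0.
Unshelve. all: by end_near. Qed.

(** Differentiation under the integral sign: the derivative in v of Im P is the real
part of z P'(z), whose integral has been found to be 0. *)
Lemma is_derive_ray_integral v : 0 < v -> v < pi -> b * v < pi *+ 2 ->
  is_derive v 1 ray_integral 0.
Proof.
move=> v0 vpi bv.
(* v2 stays below both pi and 2 pi / b *)
pose v1 := v / 2; pose v2 := Num.min ((v + pi) / 2) ((v + (pi *+ 2) / b) / 2).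
have v2b : v < pi *+ 2 / b by rewrite ltr_pdivlMr// mulrC.
have v12 : v1 < v by rewrite /v1; lra.
have vv2 : v < v2 by rewrite /v2 lt_min; apply/andP; split; lra.
have v2pi : v2 < pi by rewrite /v2 gt_min; apply/orP; left; lra.
have bv2 : b * v2 < pi *+ 2.
  by rewrite mulrC -ltr_pdivlMr// /v2 gt_min; apply/orP; right; lra.
have v10 : 0 < v1 by rewrite /v1; lra.
have [C C0 HC] := ray_local_bound v10 (ltW (lt_trans v12 vv2)) v2pi bv2.
pose f v u := complex.Im (P u v) / u.
have I_in w : `]v1, v2[%classic w -> v1 <= w <= v2.
  by rewrite /= in_itv/= => /andP[? ?]; rewrite !ltW.
have df w u : `]v1, v2[%classic w -> D u -> is_derive w 1 (f ^~ u) (complex.Re (P' u w) / u).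
  move=> /I_in wv; rewrite /= in_itv/= andbT => u0.
  have [reg _ _] := HC u w u0 wv; have [_ _ _ h] := polar_derive_rayP reg.
  have := is_deriveM h (is_derive_cst u^-1 w 1); move/is_derive_eq; apply.
  by rewrite scaler0 add0r /GRing.scale /= mulrC.
have d1 w u : `]v1, v2[%classic w -> D u -> partial1of2 f w u = complex.Re (P' u w) / u.
  by move=> Iw Du; rewrite partial1of2E; have [_ ->] := df w u Iw Du.
have Iv : `]v1, v2[%classic v by rewrite /= in_itv/= v12.
have intf w : `]v1, v2[%classic w -> mu.-integrable D (EFin \o f w).
  move=> /= ; rewrite in_itv/= => /andP[w1 w2]; apply: ray_integrable.
  - exact: lt_trans w1.
  - exact: lt_trans v2pi.
  - by rewrite (lt_trans _ bv2)// ltr_pM2l.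
have derf w u : `]v1, v2[%classic w -> D u -> derivable (f ^~ u) w 1.
  by move=> Iw Du; have [] := df w u Iw Du.
pose G u := C * (1 + u `^ b)^-1.
have G0 u : 0 <= G u by rewrite /G mulr_ge0 ?ltW// invr_gt0 ltr_pwDl// powR_ge0.
have Gub w u : `]v1, v2[%classic w -> D u -> `|partial1of2 f w u| <= G u.
  move=> Iw Du; rewrite d1//; move: Du; rewrite /= in_itv/= andbT => u0.
  have [_ _ h] := HC u w u0 (I_in _ Iw).
  by apply: ray_bound_divu => //; exact: le_trans (ler_Re_normc _) h.
have mD : measurable D by exact: measurable_itv.
have iG := integrable_ray_envelope C.
split.
  exact: (@derivable_under_integral R _ _ mu f D mD v v1 v2 Iv intf derf G G0 iG Gub).
rewrite -derive1E.
rewrite (@differentiation_under_integral R _ _ mu f D mD v v1 v2 Iv intf derf G G0 iG Gub).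
rewrite -[RHS](ray_integral_deriv_zero v0 vpi bv).
by apply: eq_Rintegral => u /set_mem Du; rewrite d1.
Qed.

Lemma ray_integral_cst v w : 0 < v -> v < w -> w < pi -> b * w < pi *+ 2 ->
  ray_integral v = ray_integral w.
Proof.
move=> v0 vw wpi bw.
have d x : v <= x -> x <= w -> is_derive x 1 ray_integral 0.
  move=> vx xw; apply: is_derive_ray_integral.
  - exact: lt_le_trans vx.
  - exact: le_lt_trans wpi.
  - by rewrite (le_lt_trans _ bw)// ler_pM2l.
have [| |x _] := @MVT _ ray_integral (fun=> 0) v w vw.
- by move=> x; rewrite in_itv/= => /andP[vx xw]; apply: d; exact: ltW.
- apply: derivable_within_continuous => x; rewrite in_itv/= => /andP[vx xw].
  by have [] := d x vx xw.
- by rewrite mul0r => /eqP; rewrite subr_eq0 => /eqP.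
Qed.

End RayRotation.

(** * The two extreme positions of the ray *)

Section RayEnds.
Variables (R : realType) (b l : R).
Hypotheses (b1 : 1 < b) (l0 : 0 < l).
Local Notation mu := (@lebesgue_measure R).
Local Notation D := (`]0, +oo[%classic : set R).
Local Notation P := (rayP b l).
Local Notation ray_integral := (ray_integral b l).
Implicit Types u v : R.

Let b0 : 0 < b. Proof. exact: lt_trans b1. Qed.

Lemma normc_1B_cpow p u v :
  normc (1 - cpow p u v) = Num.sqrt ((1 - u `^ p) ^+ 2 + 2 * u `^ p * (1 - cos (p * v))).
Proof.
rewrite normc_sqrt; congr (Num.sqrt _); rewrite /sqnormc /cpow /=.
rewrite [LHS](_ : _ = 1 - 2 * u `^ p * cos (p * v) +
  u `^ p ^+ 2 * (cos (p * v) ^+ 2 + sin (p * v) ^+ 2)); last by ring.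
by rewrite cos2Dsin2; ring.
Qed.

(** Uniformly as the angle tends to 0, the zero of 1 - z at z = 1 compensates that
of 1 - z^b. *)
Lemma ray_quotient : exists2 C, 0 < C & forall u v, 0 < u -> 0 <= v -> b * v <= pi ->
  normc (1 - cpow 1 u v) <= C * ((1 + u) / (1 + u `^ b)) * normc (1 - cpow b u v).
Proof.
pose K := 2 `^ (b - 1); pose C := 4 + K * (1 + 2 `^ b).
have K1 : 1 <= K by rewrite /K -[leLHS](powRr0 2) ler_powR ?ler1n// subr_ge0 ltW.
have bb0 : 0 < 2 `^ b :> R by rewrite powR_gt0.
exists C; first by rewrite /C addr_gt0// mulr_gt0 ?addr_gt0//; lra.
move=> u v u0 v0 bv.
have X0 : 0 < u `^ b by rewrite powR_gt0.
have n_le : normc (1 - cpow 1 u v) <= 1 + u.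
  have := ler_normcD 1 (- cpow 1 u v).
  by rewrite normcNE normc1 normc_cpow powRr1 ?(ltW u0).
have B_eq := normc_1B_cpow b u v.
have N_eq := normc_1B_cpow 1 u v.
rewrite powRr1 ?(ltW u0)// mul1r in N_eq.
set n := normc (1 - cpow 1 u v) in n_le N_eq *.
set be := normc (1 - cpow b u v) in B_eq *.
have be0 : 0 <= be := normc_ge0 _.
have be_ge : `|1 - u `^ b| <= be.
  rewrite B_eq -sqrtr_sqr ler_wsqrtr// lerDl.
  by apply: mulr_ge0; [rewrite mulr_ge0// ltW|rewrite subr_ge0 cos_le1].
set X := u `^ b in X0 be_ge B_eq *.
set Q := (1 + u) / (1 + X).
have Q0 : 0 < Q by rewrite divr_gt0// addr_gt0.
have uQ : 1 + u = Q * (1 + X) by rewrite /Q divfK// gt_eqF// addr_gt0.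
have C4 : 4 <= C by rewrite /C lerDl mulr_ge0//; lra.
have KC : K * (1 + 2 `^ b) <= C by rewrite /C lerDr.
(* away from u = 1 it suffices to bound 1 - z^b from below *)
have far : 1 + X <= 4 * be -> n <= C * Q * be.
  move=> h; apply: le_trans n_le _; rewrite uQ mulrC.
  apply: (@le_trans _ _ (4 * be * Q)); first by rewrite ler_pM2r.
  by rewrite [leRHS]mulrAC ler_wpM2r ?(ltW Q0)// ler_wpM2r.
have [u12|u12] := leP u (1 / 2).
  apply: far.
  have Xu : X <= u by rewrite /X ge1r_powR ?(ltW b1)//; lra.
  by move: be_ge; rewrite ger0_norm; lra.
have [u2|u2] := leP 2 u.
  apply: far.
  have Xu : u <= X by rewrite /X le1r_powR ?(ltW b1)//; lra.
  by move: be_ge; rewrite ler0_norm; lra.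
(* near u = 1 both squared moduli are compared summand by summand *)
have uKX : u <= K * X.
  have -> : X = u * u `^ (b - 1) by rewrite mulr_powRB1 ?(ltW u0)//; lra.
  rewrite mulrCA ler_peMr ?(ltW u0)// /K -powRM ?(ltW u0)//.
  have p1 : (1 : R) `^ (b - 1) = 1 by rewrite powR1.
  by rewrite -[leLHS]p1; apply: ge0_ler_powR; rewrite ?nnegrE; move: b1 u0 u12 => *; lra.
have XX : (1 - u) ^+ 2 <= (1 - X) ^+ 2.
  have [u1|u1] := leP u 1.
    have Xu : X <= u by rewrite /X ge1r_powR ?(ltW b1)// u0.
    by rewrite lerXn2r ?nnegrE; lra.
  have Xu : u <= X by rewrite /X le1r_powR ?(ltW b1)// ltW.
  by rewrite -sqrrN -[leRHS]sqrrN lerXn2r ?nnegrE; lra.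
have cc : cos (b * v) <= cos v.
  have vb : v <= b * v by rewrite ler_peMl// ltW.
  by rewrite leNgt ltr_cos ?in_itv/= -?leNgt//; apply/andP; split; lra.
have nK : n <= K * be.
  rewrite N_eq B_eq -[K in leRHS]ger0_norm ?(le_trans ler01 K1)//.
  rewrite -sqrtr_sqr -sqrtrM ?sqr_ge0//; apply: ler_wsqrtr.
  have c1 := cos_le1 v; have c2 := cos_le1 (b * v).
  have e1 : 2 * u * (1 - cos v) <= K * (2 * X * (1 - cos (b * v))).
    rewrite [leRHS](_ : _ = 2 * (K * X) * (1 - cos (b * v))); last by ring.
    by apply: ler_pM; rewrite ?mulr_ge0 ?(ltW u0) ?subr_ge0 ?ler_pM2l ?lerB.
  set S := 2 * X * (1 - cos (b * v)) in e1 *.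
  have S0 : 0 <= S.
    by apply: mulr_ge0; [rewrite mulr_ge0// ltW|rewrite subr_ge0 cos_le1].
  have Y0 := sqr_ge0 (1 - X).
  rewrite [leRHS]mulrDr; apply: lerD.
    by apply: le_trans XX _; rewrite ler_peMl// expr_ge1// (le_trans ler01).
  apply: le_trans e1 _; rewrite expr2 -mulrA ler_peMl// mulr_ge0//.
  exact: le_trans K1.
apply: le_trans nK _; rewrite ler_wpM2r//.
apply: (@le_trans _ _ (K * (1 + 2 `^ b) * Q)); last by rewrite ler_wpM2r// ltW.
rewrite -mulrA ler_peMr ?(le_trans ler01 K1)// /Q mulrA ler_pdivlMr ?addr_gt0// mul1r.
have X2 : X <= 2 `^ b by rewrite /X ge0_ler_powR ?nnegrE// ltW.
apply: (@le_trans _ _ (1 + 2 `^ b)); first by rewrite lerD2l.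
by rewrite ler_peMr ?addr_ge0 ?(ltW bb0)// lerDl ltW.
Qed.

End RayEnds.

Section RayLimits.
Variables (R : realType) (b l : R).
Hypotheses (b1 : 1 < b) (l0 : 0 < l).
Local Notation mu := (@lebesgue_measure R).
Local Notation D := (`]0, +oo[%classic : set R).
Local Notation P := (rayP b l).
Local Notation ray_integral := (ray_integral b l).
Implicit Types u v : R.

Let b0 : 0 < b. Proof. exact: lt_trans b1. Qed.

(** A dominating function for all small angles, the angle 0 included. *)
Lemma ray_envelope : exists2 C, 0 < C & forall u v, 0 < u -> 0 <= v -> b * v <= pi / 2 ->
  `|complex.Im (P u v) / u| <= C * (1 + u `^ b)^-1.
Proof.
have [C C0 HC] := ray_quotient b1.
pose k0 := Num.sqrt ((1 + 0) / 2) : R.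
have k00 : 0 < k0 by rewrite sqrtr_gt0 addr0 divr_gt0.
pose m := 1 + l^-1; have m0 : 0 < m by rewrite addr_gt0// invr_gt0.
exists (m * k0^-1 * C); first by rewrite !mulr_gt0// invr_gt0.
move=> u v u0 v0 bv.
have X1 : 0 < 1 + u `^ b by rewrite ltr_pwDl// powR_ge0.
have vb : v <= b * v by rewrite ler_peMl// ltW.
have cv : 0 <= cos v by apply: cos_ge0_pihalf; apply/andP; split; have := pi_ge0 R; lra.
have A_ge := rayA_den_ge l0 u0 cv (lerN10 R); rewrite -/k0 in A_ge.
have bvpi : b * v <= pi by have := pi_ge0 R; lra.
have nB := HC u v u0 v0 bvpi.
apply: ray_bound_divu => //; apply: le_trans (ler_Im_normc _) _.
have lu0 : 0 < 1 + l * u by rewrite addr_gt0// mulr_gt0.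
rewrite /rayP !normcM /rayA /rayB /rayN !normcV normc_cpow powRr1 ?(ltW u0)//.
move: nB A_ge.
set n := normc (1 - cpow 1 u v); set B := normc (1 - cpow b u v).
set A := normc (1 + _) => nB A_ge.
have n0 : 0 <= n := normc_ge0 _.
have B0 : 0 <= B := normc_ge0 _.
have A0 : 0 < A by rewrite (lt_le_trans _ A_ge)// mulr_gt0.
have {}nB : n * B^-1 <= C * ((1 + u) / (1 + u `^ b)).
  move: B0; rewrite le_eqVlt => /predU1P[<-|B0]; last by rewrite ler_pdivrMr.
  by rewrite invr0 mulr0; apply: mulr_ge0; [exact: ltW|apply: divr_ge0; [lra|exact: ltW]].
have uA : (1 + u) * A^-1 <= m * k0^-1.
  rewrite ler_pdivrMr// -mulrA.
  apply: (@le_trans _ _ (m * (1 + l * u))).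
    rewrite /m mulrDl mul1r mulrDr mulr1 mulKf ?gt_eqF//.
    have : 0 < l * u by rewrite mulr_gt0.
    have : 0 < l^-1 by rewrite invr_gt0.
    lra.
  by rewrite ler_wpM2l ?(ltW m0)// ler_pdivlMl// mulrC.
have -> : u * n * A^-1 * B^-1 = u * A^-1 * (n * B^-1) by ring.
apply: (@le_trans _ _ (u * A^-1 * (C * ((1 + u) / (1 + u `^ b))))).
  by rewrite ler_wpM2l// mulr_ge0 ?invr_ge0// ltW.
rewrite [leLHS](_ : _ = ((1 + u) * A^-1) * (C * (u / (1 + u `^ b)))); last by ring.
rewrite -[leRHS]mulrA ler_wpM2r//.
by rewrite mulr_ge0 ?divr_ge0 ?(ltW C0) ?(ltW X1) ?(ltW u0).
Qed.

Lemma Im_rayP0 u : complex.Im (P u 0) = 0.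
Proof.
have M0 (x y : R[i]) : complex.Im x = 0 -> complex.Im y = 0 -> complex.Im (x * y) = 0.
  by move=> hx hy; rewrite ImM hx hy mulr0 mul0r addr0.
have V0 (x : R[i]) : complex.Im x = 0 -> complex.Im x^-1 = 0.
  by move=> hx; rewrite ImV hx oppr0 mul0r.
have c0 p : complex.Im (cpow p u 0) = 0 by rewrite /= mulr0 sin0 mulr0.
have c1 p : complex.Im (1 - cpow p u 0) = 0 by rewrite /= mulr0 sin0 mulr0 subr0.
have c2 : complex.Im (1 + Complex l 0 * cpow 1 u 0) = 0.
  by rewrite /= !mulr0 sin0 !mulr0 !mul0r !addr0.
exact: (M0 _ _ (M0 _ _ (M0 _ _ (c0 _) (c1 _)) (V0 _ c2)) (V0 _ (c1 _))).
Qed.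

(** P is real on the real axis, so the integrand tends to 0 at every u except u = 1. *)
Lemma ray_integral_cvg0 (v_ : nat -> R) : (forall n, 0 < v_ n) ->
  (forall n, b * v_ n <= pi / 2) -> v_ n @[n --> \oo] --> (0 : R) ->
  ray_integral (v_ n) @[n --> \oo] --> (0 : R).
Proof.
move=> v0 bv v_0.
have [C C0 HC] := ray_envelope.
have -> : 0 = \int[mu]_(u in D) (0 : R).
  by rewrite /Rintegral integral0.
have pi0 := pi_gt0 R.
have vb n : v_ n <= b * v_ n by rewrite ler_peMl// ltW.
apply: (@Rdominated_cvg _ _ _ mu D _ _ (fun u => C * (1 + u `^ b)^-1)).
- exact: measurable_itv.
- move=> n.
  have /integrableP[/measurable_EFinP] := @ray_integrable R b l b1 l0 (v_ n) (v0 n)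
    (ltac:(have := bv n; have := vb n; lra)) (ltac:(rewrite mulr2n; have := bv n; lra)).
  by [].
- exact: measurable_cst.
- exists [set 1]; split; [exact: measurable_set1|exact: lebesgue_measure_set1|].
  move=> u /= /not_implyP[]; rewrite in_itv/= andbT => u0 nc; apply: contrapT => u1.
  apply: nc; rewrite -[X in _ --> X](mul0r u^-1); apply: cvgM; last exact: cvg_cst.
  have reg : ray_regular b l u 0.
    split => //.
      rewrite /cpow !mulr0 cos0 sin0 powRr1 ?(ltW u0)// eq_complex /= !mulr0 mul0r !subr0 mulr1.
      by rewrite negb_and gt_eqF// addr_gt0// mulr_gt0.
    rewrite /cpow mulr0 cos0 sin0 eq_complex /= !mulr0 mulr1 negb_and subr_eq0 eq_sym.
    by rewrite powR_eq1 (negPf (introN eqP u1)) /= ltNge (ltW u0) gt_eqF.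
  have [_ _ _ [+ _]] := polar_derive_rayP reg => /derivable1_diffP/differentiable_continuous.
  move=> h0; have h : complex.Im (P u v) @[v --> (0 : R)] --> (0 : R).
    by rewrite -[X in _ --> X](Im_rayP0 u); exact: h0.
  exact: (cvg_comp _ _ v_0 h).
- exact: integrable_ray_envelope.
- move=> n u; rewrite /= in_itv/= andbT => u0; apply: HC => //; exact: ltW.
Qed.

Lemma ray_integral_eq0 : ray_integral (pi / b) = 0.
Proof.
have pi0 := pi_gt0 R.
pose v_ n : R := (pi / b) / 2 * harmonic n.
have h01 n : 0 < (harmonic n : R) <= 1.
  by rewrite /harmonic /= invr_gt0 ltr0n /= invf_le1 ?ltr0n// ler1n.
have pb : 0 < pi / b by rewrite divr_gt0.
have v0 n : 0 < v_ n by have /andP[h0 _] := h01 n; rewrite /v_ mulr_gt0// divr_gt0.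
have vle n : v_ n <= (pi / b) / 2.
  have /andP[_ h1] := h01 n; by rewrite /v_ ler_piMr// divr_ge0// ltW.
have pib : pi / b < pi by rewrite ltr_pdivrMr// ltr_pMr.
have bpib : b * (pi / b) = pi by rewrite mulrC divfK// gt_eqF.
have E n : ray_integral (v_ n) = ray_integral (pi / b).
  apply: ray_integral_cst => //.
    by rewrite (le_lt_trans (vle n))//; lra.
  by rewrite bpib mulr2n; lra.
have := @ray_integral_cvg0 v_ v0.
rewrite (funext E) => H; apply/esym.
apply: (cvg_unique _ (H _ _)) => //; last exact: cvg_cst.
- move=> n; apply: (@le_trans _ _ (b * (pi / b / 2))); first by rewrite ler_pM2l.
  by rewrite mulrA bpib.
- rewrite -[X in _ --> X](mulr0 ((pi / b) / 2)); apply: cvgM; first exact: cvg_cst.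
  exact: cvg_harmonic.
Qed.

End RayLimits.

(** * The Stieltjes transform of the spectral density *)

Section Stieltjes.
Variables (R : realType) (b : R).
Hypothesis (b1 : 1 < b).
Local Notation mu := (@lebesgue_measure R).
Local Notation D := (`]0, +oo[%classic : set R).
Local Notation c := (cos (pi / b)).
Local Notation s := (sin (pi / b)).
Implicit Types u l : R.

Let b0 : 0 < b. Proof. exact: lt_trans b1. Qed.

(** 1 + 2 c u + u^2 = (u + c)^2 + s^2. *)
Lemma kernel_den_ge u : s ^+ 2 <= 1 + 2 * c * u + u ^+ 2.
Proof.
rewrite -subr_ge0 sin2cos2.
by rewrite [leRHS](_ : _ = (c + u) ^+ 2) ?sqr_ge0//; ring.
Qed.

Lemma sin_pib_gt0 : 0 < s.
Proof.
apply: sin_gt0_pi; rewrite divr_gt0 ?pi_gt0//= ltr_pdivrMr//.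
by rewrite ltr_pMr// pi_gt0.
Qed.

Lemma kernel_den_gt0 u : 0 < 1 + 2 * c * u + u ^+ 2.
Proof. by apply: lt_le_trans (kernel_den_ge u); rewrite exprn_gt0// sin_pib_gt0. Qed.

Lemma Im_ray_aux (x y l w : R) : (1 + l * x) ^+ 2 + (l * y) ^+ 2 != 0 ->
  let z := Complex x y in
  complex.Im (z * (1 - z) * (1 + Complex l 0 * z)^-1 * Complex w 0) =
  w * (y - 2 * x * y - l * y * (x ^+ 2 + y ^+ 2)) / ((1 + l * x) ^+ 2 + (l * y) ^+ 2).
Proof.
move=> d0 /=; rewrite !mul0r !mulr0 !subr0 !addr0 !add0r.
by field.
Qed.

(** At the angle pi / b the factor 1 - z^b = 1 + u^b is real.  The numerator
l (1 - 2 c u - l u^2) that remains is (1 + l) - (1 + 2 c l u + l^2 u^2), which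
splits the fraction in two. *)
Lemma Im_rayP_end l u : 0 < u -> 0 < l ->
  complex.Im (rayP b l u (pi / b)) / u =
  s / l * ((1 + l) * ((1 + 2 * c * (l * u) + (l * u) ^+ 2) * (1 + u `^ b))^-1
           - (1 + u `^ b)^-1).
Proof.
move=> u0 l0.
have X0 : 0 < 1 + u `^ b by rewrite ltr_pwDl// powR_ge0.
have bpib : b * (pi / b) = pi by rewrite mulrC divfK// gt_eqF.
have rB : rayB b u (pi / b) = Complex (1 + u `^ b)^-1 0.
  have -> : Complex (1 + u `^ b)^-1 0 = (Complex (1 + u `^ b) 0)^-1.
    by rewrite !complexr0 fmorphV.
  rewrite /rayB /cpow bpib cospi sinpi mulrN1 mulr0; congr (_^-1).
  by apply/eqP; rewrite eq_complex /= opprK subr0 !eqxx.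
have cs := cos2Dsin2 (pi / b).
have c1 := cos_le1 (pi / b).
have d0 : 0 < 1 + 2 * c * (l * u) + (l * u) ^+ 2.
  exact: kernel_den_gt0.
have dE : (1 + l * (u * c)) ^+ 2 + (l * (u * s)) ^+ 2 =
    1 + 2 * c * (l * u) + (l * u) ^+ 2.
  rewrite [LHS](_ : _ = 1 + 2 * c * (l * u) + (l * u) ^+ 2 * (c ^+ 2 + s ^+ 2)).
    by rewrite cs mulr1.
  by ring.
rewrite /rayP rB /rayN /rayA /cpow powRr1 ?(ltW u0)// mul1r.
rewrite Im_ray_aux; last by rewrite dE gt_eqF.
rewrite dE.
have -> : (u * c) ^+ 2 + (u * s) ^+ 2 = u ^+ 2.
  by rewrite !exprMn -mulrDr cs mulr1.
by field; rewrite !gt_eqF.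
Qed.

Lemma kernel_continuous l t u : 0 < t -> 0 < u ->
  {for u, continuous (fun u => ((1 + 2 * c * (l * u) + (l * u) ^+ 2) * (t + u `^ b))^-1)}.
Proof.
move=> t0 u0; apply: cvgV.
  by rewrite gt_eqF// mulr_gt0 ?kernel_den_gt0 ?addr_gt0 ?powR_gt0.
have cl : {for u, continuous (fun u => l * u)} by apply: cvgM; [exact: cvg_cst|exact: cvg_id].
apply: cvgM; last by apply: cvgD; [exact: cvg_cst|exact: continuous_powR_pos].
apply: cvgD; last by apply: (cvg_comp _ (fun x : R => x ^+ 2) cl); exact: exprn_continuous.
by apply: cvgD; [exact: cvg_cst|apply: cvgM; [exact: cvg_cst|exact: cl]].
Qed.

Lemma integrable_ray_kernel l t : 0 < t ->
  mu.-integrable D (EFin \o (fun u => ((1 + 2 * c * (l * u) + (l * u) ^+ 2) * (t + u `^ b))^-1)).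
Proof.
move=> t0; pose k := Num.min 1 t; have k0 : 0 < k by rewrite lt_min ltr01.
apply: (integrable_pos_le _ (pos_integrableZ ((s ^+ 2) * k)^-1 (integrable_oneDpowRV b1))).
  by apply: measurable_pos_continuous => u u0; exact: kernel_continuous.
move=> u u0; have X0 : 0 < u `^ b by rewrite powR_gt0.
have s0 := sin_pib_gt0.
rewrite ger0_norm; last first.
  by rewrite invr_ge0 ltW// mulr_gt0 ?kernel_den_gt0 ?addr_gt0.
rewrite -invfM lef_pV2 ?posrE; last 2 first.
- by rewrite mulr_gt0 ?kernel_den_gt0 ?addr_gt0.
- by rewrite !mulr_gt0 ?exprn_gt0 ?addr_gt0.
rewrite -(mulrA (s ^+ 2)); apply: ler_pM; first exact: sqr_ge0.
- by apply: mulr_ge0; [exact: ltW|rewrite ltW// addr_gt0].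
- exact: kernel_den_ge.
rewrite mulrDr mulr1 lerD//; first by rewrite ge_min lexx orbT.
by rewrite ler_piMl ?(ltW X0)// ge_min lexx.
Qed.

Lemma ray_identity l : 0 < l ->
  (1 + l) * \int[mu]_(u in D) ((1 + 2 * c * (l * u) + (l * u) ^+ 2) * (1 + u `^ b))^-1 =
  \int[mu]_(u in D) (1 + u `^ b)^-1.
Proof.
move=> l0.
have := ray_integral_eq0 b1 l0; rewrite /ray_integral.
have im := integrable_oneDpowRV b1.
have iw := integrable_ray_kernel l ltr01.
have iw2 := pos_integrableZ (1 + l) iw.
rewrite (eq_pos_Rintegral (g := fun u => s / l * ((1 + l) *
   ((1 + 2 * c * (l * u) + (l * u) ^+ 2) * (1 + u `^ b))^-1 - (1 + u `^ b)^-1))); last first.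
  by move=> u u0; exact: Im_rayP_end.
rewrite pos_RintegralZ; last exact: pos_integrableB.
rewrite pos_RintegralB// pos_RintegralZ//.
move/eqP; rewrite mulf_eq0 mulf_eq0 invr_eq0 (gt_eqF sin_pib_gt0) (gt_eqF l0) /=.
by rewrite subr_eq0 => /eqP.
Qed.

(** The case l = t^(1/b) of [ray_identity], after the substitution u -> l u. *)
Lemma stieltjes_kernel t : 0 < t ->
  \int[mu]_(u in D) ((1 + 2 * c * u + u ^+ 2) * (t + u `^ b))^-1 =
  (\int[mu]_(u in D) (1 + u `^ b)^-1) * (t `^ b^-1 / (t * (1 + t `^ b^-1))).
Proof.
move=> t0; set l := t `^ b^-1; have l0 : 0 < l by rewrite powR_gt0.
have lb : l `^ b = t by rewrite -powRrM mulVf ?gt_eqF// powRr1 ?ltW.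
rewrite -(ray_identity l0).
pose h u := ((1 + 2 * c * u + u ^+ 2) * (t + u `^ b))^-1.
have hl u : 0 < u -> h (l * u) =
    t^-1 * ((1 + 2 * c * (l * u) + (l * u) ^+ 2) * (1 + u `^ b))^-1.
  move=> u0; rewrite /h powRM ?ltW// lb -invfM; congr (_^-1); ring.
have ihl : mu.-integrable D (EFin \o (fun u => h (l * u))).
  have := pos_integrableZ t^-1 (integrable_ray_kernel l ltr01).
  by apply: eq_integrable => // u; rewrite inE /= in_itv/= andbT => u0; rewrite hl.
have E : \int[mu]_(u in D) ((1 + 2 * c * (l * u) + (l * u) ^+ 2) * (1 + u `^ b))^-1 =
    t * \int[mu]_(u in D) h (l * u).
  rewrite -pos_RintegralZ; last exact: ihl.
  by apply: eq_pos_Rintegral => u u0; rewrite hl// mulVKf ?gt_eqF.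
have h1 : (fun u => ((1 + 2 * c * (1 * u) + (1 * u) ^+ 2) * (t + u `^ b))^-1) = h.
  by apply/funext => u; rewrite mul1r.
rewrite E pos_scalingR//.
- by rewrite -/l; field; rewrite !gt_eqF// addr_gt0.
- by move=> u u0; rewrite -h1; exact: kernel_continuous.
- move=> u u0; rewrite invr_ge0 ltW// mulr_gt0 ?kernel_den_gt0//.
  by rewrite addr_gt0 ?powR_gt0.
- by rewrite -h1; exact: integrable_ray_kernel.
Qed.

End Stieltjes.

(** * Uniqueness of Laplace transforms *)

Section Lerch.
Variable R : realType.
Local Notation mu := (@lebesgue_measure R).
Local Notation D := (`]0, +oo[%classic : set R).

Lemma pos_Rintegral_indic (x y : R) : 0 < x -> x <= y ->
  mu.-integrable D (EFin \o (\1_`[x, y] : R -> R)) /\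
  \int[mu]_(t in D) \1_`[x, y] t = y - x.
Proof.
move=> x0 xy.
have E : (\int[mu]_(t in D) (\1_`[x, y] t)%:E = (y - x)%:E)%E.
  rewrite integral_indic//=.
  rewrite (_ : _ `&` _ = `[x, y]%classic); last first.
    apply/setIidl => t /=; rewrite !in_itv/= andbT => /andP[+ _].
    exact: lt_le_trans.
  rewrite lebesgue_measure_itv/= lte_fin; case: ltP => // yx.
  by have -> : x = y; [apply/eqP; rewrite eq_le xy yx|rewrite subrr].
split; last by rewrite /Rintegral E.
apply: (@integrable_ge0_fin _ _ _ (y - x)) => //.
Qed.

Lemma continuous_expRN : continuous (fun t : R => expR (- t)).
Proof.
move=> t; apply: (cvg_comp (fun t : R => - t) expR); last exact: continuous_expR.
by apply: cvgN; exact: cvg_id.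
Qed.

Lemma pos_integrable_expM (phi : R -> R) k :
  (forall t : R, 0 < t -> {for t, continuous phi}) ->
  mu.-integrable D (EFin \o phi) ->
  mu.-integrable D (EFin \o (fun t => expR (- t) ^+ k * phi t)).
Proof.
move=> cphi iphi; apply: (integrable_pos_le _ (pos_integrable_norm iphi)).
  apply: measurable_pos_continuous => t tt0; apply: cvgM; last exact: cphi.
  apply: (cvg_comp (fun t => expR (- t)) (fun x : R => x ^+ k)).
    exact: continuous_expRN.
  exact: exprn_continuous.
move=> t tt0; rewrite /= normrM ler_piMl// normrX exprn_ile1//.
by rewrite ger0_norm ?expR_ge0// expR_le1 oppr_le0 ltW.
Qed.

(** If phi t0 > 0, let q(t) = 1 + e - (exp (- t) - exp (- t0))^2 with e so small that
q is at most 1 wherever phi may be negative.  All the integrals of q^n phi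
vanish, because q^n is a polynomial in exp (- t); but near t0 one has
q >= 1 + e / 2 and phi is bounded below, so they tend to infinity. *)
Lemma exp_moments_eq0_le0 (phi : R -> R) :
  (forall t : R, 0 < t -> {for t, continuous phi}) ->
  mu.-integrable D (EFin \o phi) ->
  (forall n, \int[mu]_(t in D) (expR (- t) ^+ n * phi t) = 0) ->
  forall t : R, 0 < t -> phi t <= 0.
Proof.
move=> cphi iphi mom t0 t00; rewrite leNgt; apply/negP => phi0.
have cE := continuous_expRN.
(* V w: w phi is orthogonal to all powers of exp (- t) *)
pose V (w : R -> R) := forall k,
  mu.-integrable D (EFin \o (fun t => expR (- t) ^+ k * (w t * phi t))) /\
  \int[mu]_(t in D) (expR (- t) ^+ k * (w t * phi t)) = 0.
have V1 : V (fun=> 1).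
  move=> k.
  have E t : 0 < t -> expR (- t) ^+ k * phi t = expR (- t) ^+ k * (1 * phi t).
    by move=> _; rewrite mul1r.
  split; last by rewrite -(eq_pos_Rintegral E).
  apply: eq_pos_integrable E _.
  exact: pos_integrable_expM.
have Vq (al be ga : R) w : V w ->
    V (fun t => (al + be * expR (- t) + ga * expR (- t) ^+ 2) * w t).
  move=> Vw k.
  have [i0 e0] := Vw k; have [i1 e1] := Vw k.+1; have [i2 e2] := Vw k.+2.
  have E t : 0 < t -> al * (expR (- t) ^+ k * (w t * phi t)) +
      (be * (expR (- t) ^+ k.+1 * (w t * phi t)) +
       ga * (expR (- t) ^+ k.+2 * (w t * phi t))) = expR (- t) ^+ k *
      ((al + be * expR (- t) + ga * expR (- t) ^+ 2) * w t * phi t).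
    by move=> _; rewrite !exprS; ring.
  have j12 := pos_integrableD (pos_integrableZ be i1) (pos_integrableZ ga i2).
  split.
    exact: eq_pos_integrable E (pos_integrableD (pos_integrableZ al i0) j12).
  rewrite -(eq_pos_Rintegral E) !pos_RintegralD ?pos_RintegralZ//.
  - by rewrite e0 e1 e2 !mulr0 !addr0.
  - exact: pos_integrableZ.
  - exact: pos_integrableZ.
  - exact: pos_integrableZ.
pose u0 := expR (- t0).
have [d d0 dP] : exists2 d, 0 < d & forall t, `|t - t0| < d -> phi t0 / 2 <= phi t.
  have : \forall t \near t0, phi t0 / 2 < phi t.
    by move/cvgr_gt : (cphi _ t00); apply; lra.
  move=> /nbhs_ballP[d /= d0 dP]; exists d => // t td; apply: ltW; apply: dP.
  by rewrite /ball /= distrC.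
(* |exp (- t) - u0| >= e1 as soon as |t - t0| >= d *)
pose e1 := Num.min (u0 - expR (- (t0 + d))) (expR (- (t0 - d)) - u0).
have e10 : 0 < e1 by rewrite lt_min !subr_gt0 !ltr_expR; apply/andP; split; lra.
pose e := e1 ^+ 2; have e0 : 0 < e by rewrite exprn_gt0.
pose q t : R := 1 + e - (expR (- t) - u0) ^+ 2.
have Vqn n : V (fun t => q t ^+ n).
  elim: n => [|n IH]; first exact: V1.
  have := Vq (1 + e - u0 ^+ 2) (2 * u0) (-1) _ IH.
  congr V; apply/funext => t; rewrite /= [RHS]exprS; congr (_ * _).
  by rewrite /q; ring.
have near_ge0 t : 0 < t -> 0 <= q t.
  move=> tt0; have h1 : expR (- t) <= 1 by rewrite expR_le1 oppr_le0 ltW.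
  have h2 := expR_ge0 (- t).
  have h3 : u0 <= 1 by rewrite expR_le1 oppr_le0 ltW.
  have h4 : 0 <= u0 := expR_ge0 _.
  have : (expR (- t) - u0) ^+ 2 <= 1 by rewrite -real_normK ?num_real// expr_le1// ler_norml; lra.
  rewrite /q; move: e0; lra.
have far t : 0 < t -> d <= `|t - t0| -> `|q t| <= 1.
  move=> tt0 dt; rewrite ger0_norm ?near_ge0// /q -addrA gerDl subr_le0.
  rewrite /e -[leRHS]real_normK ?num_real// lerXn2r ?nnegrE ?(ltW e10)//.
  have [tt|tt] := leP t0 t.
    rewrite ger0_norm ?subr_ge0// in dt.
    apply: (@le_trans _ _ (u0 - expR (- (t0 + d)))); first by rewrite ge_min lexx.
    have : expR (- t) <= expR (- (t0 + d)) by rewrite ler_expR; lra.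
    by rewrite distrC => h; apply: le_trans (ler_norm _); lra.
  rewrite ltr0_norm ?subr_lt0// in dt.
  apply: (@le_trans _ _ (expR (- (t0 - d)) - u0)); first by rewrite ge_min lexx orbT.
  have h : expR (- (t0 - d)) <= expR (- t) by rewrite ler_expR; lra.
  by apply: le_trans (ler_norm _); lra.
have [r /andP[r0 rt0] rP] : exists2 r, 0 < r < t0 &
    forall t, `|t - t0| <= r -> 1 + e / 2 <= q t /\ `|t - t0| < d.
  have : \forall t \near t0, 1 + e / 2 < q t.
    have /cvgr_gt : q t @[t --> t0] --> q t0; last first.
      by apply; rewrite /q subrr expr0n subr0; lra.
    apply: cvgB; first exact: cvg_cst.
    apply: (cvg_comp (fun t => expR (- t) - u0) (fun x : R => x ^+ 2));
      last exact: exprn_continuous.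
    by apply: cvgB; [exact: cE|exact: cvg_cst].
  move=> /nbhs_ballP[p /= p0 pP].
  exists (Num.min p (Num.min d t0) / 2).
    rewrite divr_gt0 ?lt_min ?p0 ?d0//=.
    have : Num.min p (Num.min d t0) <= t0 by rewrite !ge_min lexx !orbT.
    lra.
  move=> t tr; have m0 : 0 < Num.min p (Num.min d t0) by rewrite !lt_min p0 d0.
  have mp : Num.min p (Num.min d t0) <= p by rewrite !ge_min lexx.
  have md : Num.min p (Num.min d t0) <= d by rewrite !ge_min lexx !orbT.
  split; last by lra.
  by apply: ltW; apply: pP; rewrite /ball /= distrC; lra.
have r1 : 0 < t0 - r by lra.
have r2 : t0 - r <= t0 + r by lra.
have [ii ei] := pos_Rintegral_indic r1 r2.
pose M := \int[mu]_(t in D) `|phi t|.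
have key n : phi t0 / 2 * (1 + e / 2) ^+ n * (2 * r) <= M.
  have [iq eq0] := Vqn n 0.
  have q_ge t : 0 < t -> phi t0 / 2 * (1 + e / 2) ^+ n * \1_`[t0 - r, t0 + r] t - `|phi t|
      <= expR (- t) ^+ 0 * (q t ^+ n * phi t).
    move=> tt0; rewrite expr0 mul1r.
    have q0 := near_ge0 t tt0.
    have qn0 : 0 <= q t ^+ n by rewrite exprn_ge0.
    rewrite indicE; case: (boolP (t \in _)) => [|_] /=.
      rewrite inE /= in_itv/= => /andP[t1 t2].
      have tr : `|t - t0| <= r by rewrite ler_norml; lra.
      have [qe td] := rP t tr; have pt := dP t td.
      rewrite mulr1 (@le_trans _ _ (phi t0 / 2 * (1 + e / 2) ^+ n))//.
        by rewrite gerBl.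
      have e2 : 0 <= 1 + e / 2 by move: e0; lra.
      rewrite mulrC; apply: ler_pM => //; [exact: exprn_ge0|by rewrite divr_ge0// ltW|].
      by rewrite lerXn2r ?nnegrE.
    rewrite mulr0 sub0r; have [td|td] := ltP `|t - t0| d.
      have pt := dP t td; rewrite (@le_trans _ _ 0) ?oppr_le0// mulr_ge0//; lra.
    rewrite lerNl (le_trans (ler_norm _))// normrN normrM ler_piMl//.
    by rewrite normrX exprn_ile1// far.
  have jl := pos_integrableZ (phi t0 / 2 * (1 + e / 2) ^+ n) ii.
  have jn := pos_integrable_norm iphi.
  have := le_pos_Rintegral (pos_integrableB jl jn) iq q_ge.
  rewrite eq0 pos_RintegralB// pos_RintegralZ// ei subr_le0.
  by rewrite (_ : t0 + r - (t0 - r) = 2 * r)//; ring.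
have bern n : 1 + n%:R * (e / 2) <= (1 + e / 2) ^+ n.
  elim: n => [|n IH]; first by rewrite mul0r addr0 expr0.
  rewrite exprS -natr1; have : 0 <= n%:R * (e / 2) by rewrite mulr_ge0// divr_ge0// ltW.
  move: IH e0; nra.
pose n := Num.bound (M / (phi t0 / 2 * (e / 2) * (2 * r))).
have c0 : 0 < phi t0 / 2 * (e / 2) * (2 * r) by rewrite !mulr_gt0.
have M0 : 0 <= M by apply: Rintegral_ge0.
have : M / (phi t0 / 2 * (e / 2) * (2 * r)) < n%:R.
  by apply: archi_boundP; rewrite divr_ge0// ltW.
rewrite ltr_pdivrMr// => Mn.
have := key n; apply/negP; rewrite -ltNge (lt_le_trans Mn)//.
rewrite [leLHS](_ : _ = phi t0 / 2 * (n%:R * (e / 2)) * (2 * r)); last by ring.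
rewrite ler_pM2r ?mulr_gt0// ler_pM2l ?divr_gt0//.
by apply: le_trans (bern n); rewrite lerDr.
Qed.

Lemma exp_moments_eq0 (phi : R -> R) :
  (forall t : R, 0 < t -> {for t, continuous phi}) ->
  mu.-integrable D (EFin \o phi) ->
  (forall n, \int[mu]_(t in D) (expR (- t) ^+ n * phi t) = 0) ->
  forall t : R, 0 < t -> phi t = 0.
Proof.
move=> cphi iphi mom t t0; apply/eqP; rewrite eq_le exp_moments_eq0_le0//=.
rewrite -oppr_le0; apply: (@exp_moments_eq0_le0 (fun t => - phi t)) => //.
- by move=> u u0; apply: cvgN; exact: cphi.
- have := pos_integrableZ (-1) iphi.
  by congr (is_true (integrable _ _ _)); apply/funext => x /=; rewrite mulN1r.
- move=> n; transitivity (-1 * \int[mu]_(t in D) (expR (- t) ^+ n * phi t)); last first.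
    by rewrite mom mulr0.
  rewrite -pos_RintegralZ.
    by apply: eq_pos_Rintegral => u _; rewrite mulN1r mulrN.
  exact: pos_integrable_expM.
Qed.

End Lerch.

(** * The Gamma function *)

Section GammaFacts.
Variable R : realType.
Local Notation mu := (@lebesgue_measure R).
Local Notation D := (`]0, +oo[%classic : set R).

Lemma continuous_expRZ (r : R) : continuous (fun t : R => expR (- (r * t))).
Proof.
move=> t; apply: (cvg_comp (fun t : R => - (r * t)) expR); last exact: continuous_expR.
by apply: cvgN; apply: cvgM; [exact: cvg_cst|exact: cvg_id].
Qed.

Lemma pos_integral_exp (r : R) : 0 < r ->
  (\int[mu]_(t in D) (expR (- (r * t)))%:E = (r^-1)%:E)%E.
Proof.
move=> r0.
have dE (t : R) : is_derive t 1 (fun t => - r^-1 * expR (- (r * t))) (expR (- (r * t))).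
  have d1 : is_derive t 1 (fun t => - (r * t)) (- r).
    have := is_deriveN (is_deriveZ r (is_derive_id t 1)).
    by move/is_derive_eq; apply; rewrite /GRing.scale /= mulr1.
  have := is_deriveZ (- r^-1) (@is_derive1_comp R expR (fun t => - (r * t)) t _ _
    (is_derive_expR (- (r * t))) d1).
  move/is_derive_eq; apply; rewrite /GRing.scale /=; field.
  by rewrite gt_eqF.
rewrite integral_itv_obnd_cbnd; last first.
  apply/measurable_EFinP; apply: measurable_pos_continuous => u _.
  exact: continuous_expRZ.
have -> : (r^-1)%:E = (0%:E - (- r^-1 * expR (- (r * 0)))%:E)%E :> \bar R.
  by rewrite mulr0 oppr0 expR0 mulr1 -EFinB opprK add0r.
apply: (ge0_continuous_FTC2y (F := fun t => - r^-1 * expR (- (r * t)))).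
- by move=> x _; exact: expR_ge0.
- by apply: continuous_subspaceT; exact: continuous_expRZ.
- rewrite -[X in _ --> X](mulr0 (- r^-1)); apply: cvgM; first exact: cvg_cst.
  apply: (cvg_comp (fun t => r * t) (fun x => expR (- x))); last exact: cvgr_expR.
  apply/cvgryPge => A; near=> x.
  have /ltW : A / r < x by near: x; apply: nbhs_pinfty_gt; rewrite num_real.
  by rewrite ler_pdivrMr// mulrC.
- by move=> x _; have [] := dE x.
- have [+ _] := dE 0; move=> /derivable1_diffP/differentiable_continuous.
  exact: cvg_at_right_filter.
- by move=> x _; rewrite derive1E; have [_] := dE x.
Unshelve. all: by end_near. Qed.

Lemma pos_integrable_exp (r : R) : 0 < r ->
  mu.-integrable D (EFin \o (fun t => expR (- (r * t)))).
Proof.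
move=> r0; apply: (@integrable_ge0_fin _ _ _ r^-1) => //.
- by apply: measurable_pos_continuous => u _; exact: continuous_expRZ.
- exact: pos_integral_exp.
Qed.

Definition gamma_term (p t : R) := t `^ p * expR (- t).

Lemma continuous_gamma_term (p t : R) : 0 < t -> {for t, continuous (gamma_term p)}.
Proof.
by move=> t0; apply: cvgM; [exact: continuous_powR_pos|exact: continuous_expRN].
Qed.

(** Near 0 the power is at most 1; for t >= 1 it is at most t^(n+1), which is a term
of the series of exp (t / 2) up to a factor. *)
Lemma gamma_term_le (p : R) : 0 <= p -> exists2 C, 0 < C & forall t, 0 < t ->
  gamma_term p t <= C * expR (- (2^-1 * t)).
Proof.
move=> p0; pose n := Num.bound p.
have pn : p <= n.+1%:R.
  by rewrite (le_trans (ltW (archi_boundP p0)))// ler_nat.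
exists (1 + (2 ^+ n.+1 * n.+1`!%:R) ) => [|t t0].
  by rewrite addr_gt0// mulr_gt0 ?exprn_gt0// ltr0n fact_gt0.
rewrite /gamma_term.
have -> : expR (- t) = expR (- (2^-1 * t)) * expR (- (2^-1 * t)).
  by rewrite -expRD; congr expR; field.
rewrite mulrA ler_wpM2r ?expR_ge0// expRN ler_pdivrMr ?expR_gt0//.
have t2 : 0 <= 2^-1 * t by rewrite mulr_ge0// ltW.
have e1 : 1 <= expR (2^-1 * t) by rewrite (le_trans _ (expR_ge1Dx _))// lerDl.
have m0 : 0 <= 2 ^+ n.+1 * n.+1`!%:R :> R by rewrite mulr_ge0// exprn_ge0.
have [t1|t1] := leP t 1.
  have tp : t `^ p <= 1.
    by have := @ge0_ler_powR R p p0 t 1; rewrite powR1; apply; rewrite ?nnegrE ?(ltW t0).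
  apply: le_trans tp _; apply: le_trans e1 _.
  by rewrite ler_peMl ?expR_ge0// lerDl.
apply: (@le_trans _ _ (t ^+ n.+1)).
  by rewrite -powR_mulrn ?(ltW t0)// ler_powR// ltW.
have := expR_ge1Dxn n t2.
rewrite exprMn exprVn => h.
have h2 : 2 ^- n.+1 * t ^+ n.+1 / n.+1`!%:R <= expR (2^-1 * t).
  by apply: le_trans h; rewrite lerDr.
rewrite mulrDl mul1r (@le_trans _ _ (2 ^+ n.+1 * n.+1`!%:R * expR (2^-1 * t)))//; last first.
  by rewrite lerDr expR_ge0.
move: h2; rewrite ler_pdivrMr ?ltr0n ?fact_gt0// mulrC ler_pdivrMr ?exprn_gt0// => h2.
apply: le_trans h2 _; rewrite le_eqVlt; apply/orP; left; apply/eqP; ring.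
Qed.

Lemma integrable_gamma_term (p : R) : 0 <= p -> mu.-integrable D (EFin \o gamma_term p).
Proof.
move=> p0; have [C C0 HC] := gamma_term_le p0.
apply: (integrable_pos_le _ (pos_integrableZ C (pos_integrable_exp (_ : 0 < 2^-1)))) => //.
  by apply: measurable_pos_continuous => t; exact: continuous_gamma_term.
move=> t t0; rewrite ger0_norm; first exact: HC.
by rewrite mulr_ge0 ?powR_ge0 ?expR_ge0.
Qed.

Lemma Gamma1DE (p : R) : Gamma (1 + p) = \int[mu]_(t in D) gamma_term p t.
Proof. by apply: eq_Rintegral => t _; rewrite addrAC subrr add0r. Qed.

Lemma Gamma1D0 : Gamma (1 + 0 : R) = 1.
Proof.
rewrite Gamma1DE /Rintegral.
have -> : (\int[mu]_(t in D) (gamma_term 0 t)%:E = \int[mu]_(t in D) (expR (- (1 * t)))%:E)%E.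
  by apply: eq_integral => t _; rewrite /gamma_term powRr0 !mul1r.
by rewrite pos_integral_exp// invr1.
Qed.

(** The integrand is at least the left-hand side on the segment [T, T + 1]. *)
Lemma Gamma1D_ge (p T : R) : 0 <= p -> 0 < T ->
  T `^ p * expR (- (T + 1)) <= Gamma (1 + p).
Proof.
move=> p0 T0; rewrite Gamma1DE.
have [ii ei] := @pos_Rintegral_indic R T (T + 1) T0 (ltac:(lra)).
have := le_pos_Rintegral (pos_integrableZ (T `^ p * expR (- (T + 1))) ii)
  (integrable_gamma_term p0).
rewrite pos_RintegralZ// ei addrAC subrr add0r mulr1; apply => t t0.
rewrite indicE; case: (boolP (t \in _)) => [|_] /=; last first.
  by rewrite mulr0 mulr_ge0 ?powR_ge0 ?expR_ge0.
rewrite inE /= in_itv/= => /andP[Tt tT]; rewrite mulr1.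
rewrite ler_pM ?powR_ge0 ?expR_ge0//; last by rewrite ler_expR lerN2.
by rewrite ge0_ler_powR ?nnegrE ?(ltW T0) ?(ltW t0).
Qed.

Lemma Gamma1D_gt0 (p : R) : 0 <= p -> 0 < Gamma (1 + p).
Proof.
move=> p0; apply: lt_le_trans (Gamma1D_ge p0 ltr01).
by rewrite powR1 mul1r expR_gt0.
Qed.

Lemma laplace_powR (p r : R) : 0 <= p -> 0 < r ->
  mu.-integrable D (EFin \o (fun t => expR (- (r * t)) * t `^ p)) /\
  \int[mu]_(t in D) (expR (- (r * t)) * t `^ p) = Gamma (1 + p) / (r * r `^ p).
Proof.
move=> p0 r0.
have rp0 : 0 < r `^ p by rewrite powR_gt0.
have E t : 0 < t -> (r `^ p)^-1 * gamma_term p (r * t) = expR (- (r * t)) * t `^ p.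
  by move=> t0; rewrite /gamma_term powRM ?(ltW r0) ?(ltW t0)// -mulrA mulKf ?gt_eqF// mulrC.
have cg := @continuous_gamma_term p.
have g0 t : 0 < t -> 0 <= gamma_term p t by rewrite mulr_ge0 ?powR_ge0 ?expR_ge0.
have ig := integrable_gamma_term p0.
have igr := pos_integrable_scaling r0 cg g0 ig.
split; first exact: eq_pos_integrable E (pos_integrableZ _ igr).
rewrite -(eq_pos_Rintegral E) pos_RintegralZ// pos_scalingR// Gamma1DE.
by field; rewrite !gt_eqF.
Qed.

End GammaFacts.

(** * The Mittag-Leffler function and its Laplace transform *)

Section MittagLefflerFacts.
Variables (R : realType) (a : R).
Hypothesis a0 : 0 < a.
Local Notation mu := (@lebesgue_measure R).
Local Notation D := (`]0, +oo[%classic : set R).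
Implicit Types (z w t r : R).

Definition ml_coef (k : nat) : R := (Gamma (1 + a * k%:R))^-1.

Let ak0 (k : nat) : 0 <= a * k%:R. Proof. by rewrite mulr_ge0// ltW. Qed.

Lemma ml_coef_gt0 k : 0 < ml_coef k.
Proof. by rewrite invr_gt0 Gamma1D_gt0. Qed.

(** The lower bound on Gamma grows like T^(a k) for any T; the choice T^a = 4 M beats
M^k geometrically. *)
Lemma ml_coef_le (M : R) : 0 < M ->
  exists2 C, 0 < C & forall k, M ^+ k * ml_coef k <= C * 4^-1 ^+ k.
Proof.
move=> M0; pose T := (4 * M) `^ a^-1.
have T0 : 0 < T by rewrite powR_gt0// mulr_gt0.
exists (expR (T + 1)); first exact: expR_gt0.
move=> k; have := Gamma1D_ge (ak0 k) T0.
have -> : T `^ (a * k%:R) = (4 * M) ^+ k.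
  by rewrite /T -powRrM mulKf ?gt_eqF// powR_mulrn// mulr_ge0// ltW.
move=> h; rewrite /ml_coef ler_pdivrMr ?Gamma1D_gt0//.
have {}h := ler_wpM2l (expR_ge0 (T + 1)) h.
have e1 : expR (T + 1) * ((4 * M) ^+ k * expR (- (T + 1))) = (4 * M) ^+ k.
  by rewrite mulrCA -expRD subrr expR0 mulr1.
rewrite e1 in h.
rewrite mulrAC exprVn ler_pdivlMr ?exprn_gt0//.
by rewrite -exprMn (mulrC M).
Qed.

Lemma cvg_ml_series z : cvgn (series (fun k => z ^+ k * ml_coef k)).
Proof.
apply: normed_cvg.
have M0 : 0 < `|z| + 1 by rewrite ltr_wpDl.
have [C C0 HC] := ml_coef_le M0.
apply: (series_le_cvg (v_ := geometric C 4^-1)).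
- by move=> k; exact: normr_ge0.
- by move=> k; rewrite /geometric /= mulr_ge0 ?(ltW C0).
- move=> k; rewrite /geometric /= normrM normrX (gtr0_norm (ml_coef_gt0 k)).
  apply: le_trans (HC k); rewrite ler_wpM2r ?(ltW (ml_coef_gt0 k))//.
  by rewrite lerXn2r ?nnegrE ?addr_ge0// lerDl.
- by apply: is_cvg_geometric_series; rewrite ger0_norm// invf_lt1 ?ltr1n.
Qed.

Lemma cvg_MittagLeffler z :
  series (fun k => z ^+ k * ml_coef k) @ \oo --> MittagLeffler a z.
Proof. exact: cvg_ml_series. Qed.

Lemma MittagLeffler0 : MittagLeffler a 0 = 1 :> R.
Proof.
suff h : series (fun k => 0 ^+ k * ml_coef k) @ \oo --> (1 : R).
  exact: (cvg_unique _ (@cvg_MittagLeffler 0) h).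
apply: cvg_near_cst; near=> n.
have n0 : (0 < n)%N by near: n; exists 1%N.
rewrite -(prednK n0) /series /= big_nat_recl//= expr0 mul1r.
rewrite big1 ?addr0; last by move=> i _; rewrite exprS !mul0r.
by rewrite /ml_coef mulr0 Gamma1D0 invr1.
Unshelve. all: by end_near. Qed.

Lemma subrX_le (M z w : R) k : 1 <= M -> `|z| <= M -> `|w| <= M ->
  `|z ^+ k - w ^+ k| <= `|z - w| * (2 * M) ^+ k.
Proof.
move=> M1 zM wM; elim: k => [|k IH]; first by rewrite subrr normr0 mulr_ge0.
have -> : z ^+ k.+1 - w ^+ k.+1 = z * (z ^+ k - w ^+ k) + (z - w) * w ^+ k.
  by rewrite !exprS; ring.
apply: le_trans (ler_normD _ _) _; rewrite !normrM normrX.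
have M0 : 0 <= M by apply: le_trans M1.
apply: (@le_trans _ _ (M * (`|z - w| * (2 * M) ^+ k) + `|z - w| * (M * (2 * M) ^+ k))).
  apply: lerD; first by rewrite ler_pM.
  rewrite ler_wpM2l//; apply: (@le_trans _ _ (M ^+ k)).
    by rewrite lerXn2r ?nnegrE.
  apply: (@le_trans _ _ ((2 * M) ^+ k)).
    by rewrite lerXn2r ?nnegrE ?mulr_ge0// ler_peMl// ler1n.
  by rewrite ler_peMl// exprn_ge0// mulr_ge0.
by rewrite exprS; lra.
Qed.

(** Term by term with [subrX_le]; by [ml_coef_le] for the radius 2 M the constants
are summable. *)
Lemma MittagLeffler_lipschitz (M : R) : 1 <= M ->
  exists2 L, 0 < L & forall z w,
  `|z| <= M -> `|w| <= M -> `|MittagLeffler a z - MittagLeffler a w| <= L * `|z - w|.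
Proof.
move=> M1; have M0 : 0 < M by exact: lt_le_trans M1.
have M20 : 0 < 2 * M by rewrite mulr_gt0.
have [C C0 HC] := ml_coef_le M20.
exists (C * 2) => [|z w zM wM]; first by rewrite mulr_gt0.
have h : `|series (fun k => z ^+ k * ml_coef k) n - series (fun k => w ^+ k * ml_coef k) n|
    @[n --> \oo] --> `|MittagLeffler a z - MittagLeffler a w|.
  by apply: cvg_norm; apply: cvgB; exact: (@cvg_MittagLeffler _).
rewrite -(cvg_lim _ h)//; apply: limr_le; first by apply/cvg_ex; eexists; exact: h.
near=> n; rewrite /= /series /= -sumrB.
apply: le_trans (ler_norm_sum _ _ _) _.
apply: (@le_trans _ _ (\sum_(0 <= k < n) `|z - w| * C * 2^-1 ^+ k)).
  apply: ler_sum => k _; rewrite -mulrBl normrM (gtr0_norm (ml_coef_gt0 k)).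
  apply: (@le_trans _ _ (`|z - w| * (2 * M) ^+ k * ml_coef k)).
    by rewrite ler_wpM2r ?(ltW (ml_coef_gt0 k))// subrX_le.
  rewrite -!mulrA ler_wpM2l//; apply: le_trans (HC k) _.
  rewrite ler_pM2l// lerXn2r ?nnegrE// lef_pV2 ?posrE//.
  by rewrite ler_nat.
rewrite -mulr_sumr [leRHS](_ : _ = `|z - w| * C * 2); last by ring.
rewrite ler_wpM2l ?mulr_ge0 ?(ltW C0)//.
have -> : \sum_(0 <= k < n) 2^-1 ^+ k = 2 - 2 * 2^-1 ^+ n :> R.
  elim: (n) => [|m IH]; first by rewrite big_geq// expr0 mulr1 subrr.
  by rewrite big_nat_recr//= IH exprS; field.
by rewrite gerBl mulr_ge0.
Unshelve. all: by end_near. Qed.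

Lemma continuous_MittagLeffler : continuous (MittagLeffler a : R -> R).
Proof.
move=> z; pose M := `|z| + 1.
have M1 : 1 <= M by rewrite /M lerDr.
have [L L0 HL] := MittagLeffler_lipschitz M1.
apply/cvgrPdist_lt => e e0; near=> w.
have wz : `|z - w| < Num.min 1 (e / L).
  by near: w; apply: cvgr_dist_lt; [exact: cvg_id|rewrite lt_min ltr01 divr_gt0].
move: wz; rewrite lt_min => /andP[w1 we].
apply: le_lt_trans (HL _ _ _ _) _; first by rewrite /M lerDl.
- rewrite /M -[w](subrK z); apply: le_trans (ler_normD _ _) _.
  by rewrite addrC lerD2l -normrN opprB ltW.
- by rewrite mulrC -ltr_pdivlMr.
Unshelve. all: by end_near. Qed.

Lemma nneseries_EFin (x : nat -> R) (l : R) : series x @ \oo --> l ->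
  (\sum_(k <oo) (x k)%:E = l%:E)%E.
Proof.
move=> xl; apply: cvg_lim => //.
rewrite [X in X @ _](_ : _ = EFin \o series x); last first.
  by apply/funext => n /=; rewrite sumEFin.
by apply: cvg_EFin => //; exact: nearW.
Qed.

Section Laplace.
Variable r : R.
Hypothesis r1 : 1 < r.

Let r0 : 0 < r. Proof. exact: lt_trans r1. Qed.

Let wt k t : R := expR (- (r * t)) * ((t `^ a) ^+ k * ml_coef k).

Let wtE k t : 0 < t -> wt k t = ml_coef k * (expR (- (r * t)) * t `^ (a * k%:R)).
Proof.
by move=> t0; rewrite /wt powRrM powR_mulrn ?powR_ge0//; ring.
Qed.

Let rho := r `^ (- a).

Let rho01 : 0 < rho < 1.
Proof.
rewrite powR_gt0//= /rho powRN invf_lt1 ?powR_gt0//.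
have := @gt0_ltr_powR R a a0 1 r; rewrite powR1; apply => //; rewrite nnegrE//.
exact: ltW.
Qed.

Let wt_int k : mu.-integrable D (EFin \o wt k) /\
  \int[mu]_(t in D) wt k t = r^-1 * rho ^+ k.
Proof.
have [i1 e1] := laplace_powR (ak0 k) r0.
have E t : 0 < t -> ml_coef k * (expR (- (r * t)) * t `^ (a * k%:R)) = wt k t.
  by move=> t0; rewrite wtE.
split; first exact: eq_pos_integrable E (pos_integrableZ _ i1).
rewrite -(eq_pos_Rintegral E) pos_RintegralZ// e1 /ml_coef /rho.
rewrite powRN exprVn -powR_mulrn ?powR_ge0// -powRrM.
have := Gamma1D_gt0 (ak0 k); have := powR_gt0 (a * k%:R) r0 => h1 h2.
by field; rewrite !gt_eqF.
Qed.

Let g t := expR (- (r * t)) * MittagLeffler a (t `^ a).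

Let cg t : series (wt ^~ t) @ \oo --> g t.
Proof.
rewrite [X in X @ _](_ : _ = (fun n => expR (- (r * t)) *
      series (fun k => (t `^ a) ^+ k * ml_coef k) n)).
  by apply: cvgM; [exact: cvg_cst|exact: cvg_MittagLeffler].
by apply/funext => n; rewrite /series /= mulr_sumr.
Qed.

Let wt_ge0 k t : 0 <= wt k t.
Proof.
by rewrite mulr_ge0 ?expR_ge0// mulr_ge0 ?exprn_ge0 ?powR_ge0// ltW// ml_coef_gt0.
Qed.

Let mw k : measurable_fun D (wt k).
Proof. by have [/integrableP[/measurable_EFinP]] := wt_int k. Qed.

Lemma continuous_ML_comp (f : R -> R) t : {for t, continuous f} ->
  {for t, continuous (fun t => MittagLeffler a (f t))}.
Proof.
by move=> cf; apply: (cvg_comp f (MittagLeffler a) cf); exact: continuous_MittagLeffler.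
Qed.

Let ig : mu.-integrable D (EFin \o g).
Proof.
have /andP[rho0 rho1] := rho01.
apply: (@integrable_ge0_fin _ _ _ (r^-1 * (1 - rho)^-1)) => //.
- apply: measurable_pos_continuous => t t0; apply: cvgM; first exact: continuous_expRZ.
  exact: (@continuous_ML_comp (@powR R ^~ a) t (continuous_powR_pos t0)).
- move=> t _; have h := @cg t; rewrite -(cvg_lim _ h)//; apply: limr_ge.
    by apply/cvg_ex; eexists; exact: h.
  by near=> n; apply: sumr_ge0.
- transitivity (\int[mu]_(t in D) (\sum_(k <oo) (wt k t)%:E))%E.
    by apply: eq_integral => t _; rewrite (nneseries_EFin (@cg t)).
  rewrite integral_nneseries; [|exact: measurable_itv
    |by move=> n; apply/measurable_EFinP; exact: mw|by move=> n t _; rewrite lee_fin].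
  have E n : (\int[mu]_(t in D) (wt n t)%:E = (r^-1 * rho ^+ n)%:E)%E.
    by have [i1 <-] := wt_int n; rewrite pos_EFin_Rintegral.
  rewrite (eq_eseriesr (fun n _ => E n)).
  apply: nneseries_EFin.
  by apply: cvg_geometric_series; rewrite ger0_norm// ltW.
Unshelve. all: by end_near. Qed.

Let ft t := expR (- (r * t)) * MittagLeffler a (- t `^ a).

Let cf t : series (fun k => (-1) ^+ k * wt k t) @ \oo --> ft t.
Proof.
rewrite [X in X @ _](_ : _ = (fun n => expR (- (r * t)) *
      series (fun k => (- t `^ a) ^+ k * ml_coef k) n)).
  by apply: cvgM; [exact: cvg_cst|exact: cvg_MittagLeffler].
apply/funext => n; rewrite /series /= mulr_sumr; apply: eq_bigr => k _.
by rewrite [in RHS]exprNn /wt; ring.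
Qed.

Let mf : measurable_fun D ft.
Proof.
apply: measurable_pos_continuous => t t0; apply: cvgM; first exact: continuous_expRZ.
apply: (@continuous_ML_comp (fun t => - t `^ a) t).
by apply: cvgN; exact: continuous_powR_pos.
Qed.

Let le_g n t : `|series (fun k => (-1) ^+ k * wt k t) n| <= g t.
Proof.
apply: (@le_trans _ _ (series (wt ^~ t) n)).
  rewrite /series /=; apply: le_trans (ler_norm_sum _ _ _) _.
  by apply: ler_sum => k _; rewrite normrM normrX normrN1 expr1n mul1r ger0_norm.
have h := @cg t; rewrite -(cvg_lim _ h)//; apply: nondecreasing_cvgn_le.
  by apply: nondecreasing_series => k _ _.
by apply/cvg_ex; eexists; exact: h.
Qed.

(** The partial sums are dominated by the series with all signs positive, whose
integral is the sum of a geometric series; this is where r > 1 enters. *)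
Lemma integrable_laplace_ML : mu.-integrable D (EFin \o ft).
Proof.
apply: (integrable_pos_le mf ig) => t t0.
have h : `|series (fun k => (-1) ^+ k * wt k t) n| @[n --> \oo] --> `|ft t|.
  by apply: cvg_norm; exact: (@cf t).
rewrite -(cvg_lim _ h)//; apply: limr_le.
  by apply/cvg_ex; eexists; exact: h.
by near=> n; exact: le_g.
Unshelve. all: by end_near. Qed.

Lemma laplace_ML : \int[mu]_(t in D) ft t = r `^ a / (r * (1 + r `^ a)).
Proof.
have /andP[rho0 rho1] := rho01.
have h2 n : mu.-integrable D (EFin \o (fun t => series (fun k => (-1) ^+ k * wt k t) n)) /\
  \int[mu]_(t in D) series (fun k => (-1) ^+ k * wt k t) n = series (geometric r^-1 (- rho)) n.
  have S0 (x : nat -> R) : series x 0%N = 0 by rewrite /series /= big_geq.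
  have SS (x : nat -> R) m : series x m.+1 = series x m + x m.
    by rewrite /series /= big_nat_recr.
  elim: n => [|n [IH1 IH2]].
    rewrite S0; have E t : 0 < t -> 0 * wt 0 t = series (fun k => (-1) ^+ k * wt k t) 0%N.
      by move=> _; rewrite S0 mul0r.
    split; first exact: eq_pos_integrable E (pos_integrableZ _ (wt_int 0).1).
    by rewrite -(eq_pos_Rintegral E) pos_RintegralZ ?mul0r//; exact: (wt_int 0).1.
  have E t : 0 < t -> series (fun k => (-1) ^+ k * wt k t) n + (-1) ^+ n * wt n t =
      series (fun k => (-1) ^+ k * wt k t) n.+1 by rewrite SS.
  have [i1 e1] := wt_int n.
  have i2 := pos_integrableZ ((-1) ^+ n) i1.
  split; first exact: eq_pos_integrable E (pos_integrableD IH1 i2).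
  rewrite -(eq_pos_Rintegral E) pos_RintegralD// pos_RintegralZ// IH2 SS e1.
  by rewrite /geometric /= [in RHS]exprNn; ring.
have h1 : \int[mu]_(t in D) series (fun k => (-1) ^+ k * wt k t) n @[n --> \oo] -->
    \int[mu]_(t in D) ft t.
  apply: (@Rdominated_cvg _ _ _ mu D _ _ g) => //.
  - by move=> n; have [/integrableP[/measurable_EFinP]] := h2 n.
  - by apply: aeW => t _; exact: cf.
rewrite (funext (fun n => (h2 n).2)) in h1.
have := @cvg_geometric_series R r^-1 (- rho); rewrite normrN ger0_norm ?(ltW rho0)//.
move=> /(_ rho1) h3; rewrite (cvg_unique _ h1 h3)// opprK /rho powRN.
have := powR_gt0 a r0 => ra0.
by field; rewrite !gt_eqF ?addr_gt0.
Qed.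

End Laplace.
End MittagLefflerFacts.

(** * The spectral integral and its Laplace transform *)

Section SpectralKernel.
Variables (R : realType) (b : R).
Hypothesis (b1 : 1 < b).
Local Notation mu := (@lebesgue_measure R).
Local Notation D := (`]0, +oo[%classic : set R).
Local Notation v := (pi / b).
Local Notation c := (cos v).
Local Notation s := (sin v).
Implicit Types u t : R.

Let b0 : 0 < b. Proof. exact: lt_trans b1. Qed.
Let s0 : 0 < s. Proof. exact: sin_pib_gt0. Qed.

Definition kern u : R := (1 + 2 * c * u + u ^+ 2)^-1.

Lemma kern_gt0 u : 0 < kern u.
Proof. by rewrite invr_gt0 kernel_den_gt0. Qed.

Lemma continuous_kern : continuous kern.
Proof.
move=> u; apply: cvgV; first by rewrite gt_eqF// kernel_den_gt0.
apply: cvgD; last exact: exprn_continuous.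
by apply: cvgD; [exact: cvg_cst|apply: cvgM; [exact: cvg_cst|exact: cvg_id]].
Qed.

(** The cotangent of w is the tangent of pi / 2 - w. *)
Lemma atan_cot (w : R) : 0 < w < pi -> atan (cos w / sin w) = pi / 2 - w.
Proof.
move=> /andP[w0 wpi].
have -> : cos w / sin w = tan (pi / 2 - w).
  rewrite /tan sinB cosB sin_pihalf cos_pihalf !mul0r !mul1r subr0 add0r.
  by rewrite ?subr0 ?addr0.
by rewrite tanK// in_itv/=; apply/andP; split; lra.
Qed.

Definition kern_prim u : R := s^-1 * atan ((u + c) / s).

Lemma is_derive_kern_prim u : is_derive u 1 kern_prim (kern u).
Proof.
have d1 : is_derive u 1 (fun u => (u + c) / s) s^-1.
  have := is_deriveM (is_deriveD (is_derive_id u 1) (is_derive_cst c u 1)) (is_derive_cst s^-1 u 1).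
  by move/is_derive_eq; apply; rewrite /GRing.scale /=; ring.
have := is_deriveZ s^-1 (@is_derive1_comp R atan (fun u => (u + c) / s) u _ _
    (is_derive1_atan _) d1).
move/is_derive_eq; apply; rewrite /GRing.scale /= /kern.
have E : 1 + 2 * c * u + u ^+ 2 = s ^+ 2 + (u + c) ^+ 2.
  by rewrite sin2cos2; ring.
have := kernel_den_gt0 b1 u; rewrite E => d0.
by field; rewrite !gt_eqF//= addrC; move: d0; rewrite addrC.
Qed.

Lemma kern_prim0 : kern_prim 0 = s^-1 * (pi / 2 - v).
Proof.
rewrite /kern_prim add0r atan_cot// divr_gt0 ?pi_gt0//= ltr_pdivrMr//.
by rewrite ltr_pMr// pi_gt0.
Qed.

(** The half-angle formula (1 + cos v) / sin v = cot (v / 2). *)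
Lemma kern_prim1 : kern_prim 1 = s^-1 * (pi / 2 - v / 2).
Proof.
have vpi : 0 < v < pi by rewrite divr_gt0 ?pi_gt0//= ltr_pdivrMr// ltr_pMr// pi_gt0.
rewrite /kern_prim -atan_cot; last by move: vpi => /andP[v0 v1]; apply/andP; split; lra.
congr (_ * atan _).
have e : v = (v / 2) *+ 2 by rewrite mulr2n -splitr.
have s20 : 0 < sin (v / 2).
  by apply: sin_gt0_pi; move: vpi => /andP[v0 v1]; apply/andP; split; lra.
have := s0; rewrite e sin_mulr2n cos_mulr2n -e; move: (sin (v / 2)) (cos (v / 2)) s20 => S C S0.
rewrite !mulr2n => h; field.
by rewrite !gt_eqF//; move: h; nra.
Qed.

Lemma kern_integral01 : \int[mu]_(u in `[0, 1]) kern u = v / 2 / s.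
Proof.
rewrite /Rintegral (continuous_FTC2 ltr01 (F := kern_prim)).
- by rewrite kern_prim0 kern_prim1 /=; field; rewrite !gt_eqF.
- by apply: continuous_subspaceT; exact: continuous_kern.
- split.
  + by move=> x _; have [] := is_derive_kern_prim x.
  + have [+ _] := is_derive_kern_prim 0; move=> /derivable1_diffP/differentiable_continuous.
    exact: cvg_at_right_filter.
  + have [+ _] := is_derive_kern_prim 1; move=> /derivable1_diffP/differentiable_continuous.
    exact: cvg_at_left_filter.
- by move=> x _; rewrite derive1E; have [_] := is_derive_kern_prim x.
Qed.

Lemma kern_integral_ereal : (\int[mu]_(u in D) (kern u)%:E = (v / s)%:E)%E.
Proof.
rewrite integral_itv_obnd_cbnd; last first.
  apply/measurable_EFinP; apply: measurable_pos_continuous => u _.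
  exact: continuous_kern.
rewrite (ge0_continuous_FTC2y (F := kern_prim) (l := s^-1 * (pi / 2))).
- by rewrite kern_prim0 -EFinB; congr EFin; field; rewrite !gt_eqF.
- by move=> x _; rewrite ltW// kern_gt0.
- by apply: continuous_subspaceT; exact: continuous_kern.
- apply: cvgM; first exact: cvg_cst.
  apply: (cvg_comp (fun u => (u + c) / s) atan); last exact: cvgy_atan.
  apply/cvgryPge => A; near=> x.
  have /ltW : A * s - c < x by near: x; apply: nbhs_pinfty_gt; rewrite num_real.
  by rewrite ler_pdivlMr// lerBlDr.
- by move=> x _; have [] := is_derive_kern_prim x.
- have [+ _] := is_derive_kern_prim 0; move=> /derivable1_diffP/differentiable_continuous.
  exact: cvg_at_right_filter.
- by move=> x _; rewrite derive1E; have [_] := is_derive_kern_prim x.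
Unshelve. all: by end_near. Qed.

Lemma integrable_kern : mu.-integrable D (EFin \o kern).
Proof.
apply: (@integrable_ge0_fin _ _ _ (v / s)) => //.
- by apply: measurable_pos_continuous => u _; exact: continuous_kern.
- by move=> u _; rewrite ltW// kern_gt0.
- exact: kern_integral_ereal.
Qed.

Lemma kern_integral : \int[mu]_(u in D) kern u = v / s.
Proof. by rewrite /Rintegral kern_integral_ereal. Qed.

End SpectralKernel.

Section SpectralIntegral.
Variables (R : realType) (b : R).
Hypothesis (b1 : 1 < b).
Local Notation mu := (@lebesgue_measure R).
Local Notation D := (`]0, +oo[%classic : set R).
Local Notation c := (cos (pi / b)).
Local Notation kern := (kern b).
Implicit Types u t r : R.

Let b0 : 0 < b. Proof. exact: lt_trans b1. Qed.

Definition spectral t : R := \int[mu]_(u in D) (expR (- (u `^ b * t)) * kern u).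

Let continuous_expb t u : 0 < u -> {for u, continuous (fun u => expR (- (u `^ b * t)))}.
Proof.
move=> u0; apply: (cvg_comp (fun u : R => - (u `^ b * t)) expR); last exact: continuous_expR.
by apply: cvgN; apply: cvgM; [exact: continuous_powR_pos|exact: cvg_cst].
Qed.

Let expb_le1 t u : 0 <= t -> expR (- (u `^ b * t)) <= 1.
Proof. by move=> t0; rewrite expR_le1 oppr_le0 mulr_ge0// powR_ge0. Qed.

Let continuous_spectral_term t u : 0 < u ->
  {for u, continuous (fun u => expR (- (u `^ b * t)) * kern u)}.
Proof. by move=> u0; apply: cvgM; [exact: continuous_expb|exact: continuous_kern]. Qed.

Let spectral_term_ge0 t u : 0 <= expR (- (u `^ b * t)) * kern u.
Proof. by rewrite mulr_ge0 ?expR_ge0// ltW// kern_gt0. Qed.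

Let spectral_term_le t u : 0 <= t -> `|expR (- (u `^ b * t)) * kern u| <= kern u.
Proof.
move=> t0; rewrite ger0_norm// ler_piMl// ?expb_le1//.
by rewrite ltW// kern_gt0.
Qed.

Lemma integrable_spectral t : 0 <= t ->
  mu.-integrable D (EFin \o (fun u => expR (- (u `^ b * t)) * kern u)).
Proof.
move=> t0; apply: (integrable_pos_le _ (integrable_kern b1)).
  by apply: measurable_pos_continuous => u; exact: continuous_spectral_term.
by move=> u _; exact: spectral_term_le.
Qed.

Lemma spectral_ge0 t : 0 <= spectral t.
Proof. by apply: Rintegral_ge0 => u _; exact: spectral_term_ge0. Qed.

Lemma continuous_spectral t : 0 < t -> {for t, continuous spectral}.
Proof.
move=> t0.
have mD : measurable D by exact: measurable_itv.
apply: (@continuity_under_integral R _ _ mu (fun t u => expR (- (u `^ b * t)) * kern u) D mD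
   0 (t + 1) _ _ kern).
- by move=> x /=; rewrite in_itv/= => /andP[x0 _]; apply: integrable_spectral; exact: ltW.
- apply: aeW => u _ x _; apply: cvgM; last exact: cvg_cst.
  apply: (cvg_comp (fun t => - (u `^ b * t)) expR); last exact: continuous_expR.
  by apply: cvgN; apply: cvgM; [exact: cvg_cst|exact: cvg_id].
- exact: integrable_kern.
- move=> x /=; rewrite in_itv/= => /andP[x0 _]; apply: aeW => u _.
  by apply: spectral_term_le; exact: ltW.
- by rewrite inE /= in_itv/= t0 ltrDl ltr01.
Qed.

Lemma spectral_cvg0 (t_ : nat -> R) : (forall n, 0 <= t_ n) ->
  t_ n @[n --> \oo] --> (0 : R) ->
  spectral (t_ n) @[n --> \oo] --> (pi / b) / sin (pi / b).
Proof.
move=> t0 tc; rewrite -kern_integral//.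
apply: (@Rdominated_cvg _ _ _ mu D _ _ kern).
- exact: measurable_itv.
- by move=> n; apply: measurable_pos_continuous => u; exact: continuous_spectral_term.
- by apply: measurable_pos_continuous => u _; exact: continuous_kern.
- apply: aeW => u _; rewrite -[X in _ --> X]mul1r; apply: cvgM; last exact: cvg_cst.
  rewrite -expR0 -oppr0 -(mulr0 (u `^ b)).
  apply: (cvg_comp (fun n => - (u `^ b * t_ n)) expR); last exact: continuous_expR.
  by apply: cvgN; apply: cvgM; [exact: cvg_cst|exact: tc].
- exact: integrable_kern.
- by move=> n u _; exact: spectral_term_le.
Qed.

(** Tonelli for the integrand exp (- r t) exp (- u^b t) / (1 + 2 c u + u^2). *)
Lemma laplace_spectral r : 0 < r ->
  mu.-integrable D (EFin \o (fun t => expR (- (r * t)) * spectral t)) /\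
  \int[mu]_(t in D) (expR (- (r * t)) * spectral t) =
  \int[mu]_(u in D) ((1 + 2 * c * u + u ^+ 2) * (r + u `^ b))^-1.
Proof.
move=> r0.
pose F (z : R * R) : \bar R :=
  ((\1_D z.1 * \1_D z.2) * (expR (- (r * z.1)) * (expR (- (z.2 `^ b * z.1)) * kern z.2)))%:E.
have mF : measurable_fun setT F.
  apply/measurable_EFinP; apply: measurable_funM.
    apply: measurable_funM; (apply: measurableT_comp; [exact: measurable_indic|]).
      exact: measurable_fst.
    exact: measurable_snd.
  have mk : measurable_fun setT kern by apply: continuous_measurable_fun; exact: continuous_kern.
  have mb : measurable_fun setT (fun u : R => u `^ b) by exact: measurable_powR.
  have m1 : measurable_fun [set: R * R] (fun z => - (r * z.1)).
    apply: measurable_funN.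
    by apply: measurable_funM; [exact: measurable_cst|exact: measurable_fst].
  have m2 : measurable_fun [set: R * R] (fun z => - (z.2 `^ b * z.1)).
    apply: measurable_funN.
    apply: measurable_funM; last exact: measurable_fst.
    exact: (measurableT_comp mb measurable_snd).
  apply: measurable_funM; first exact: (measurableT_comp (@measurable_expR R) m1).
  apply: measurable_funM; first exact: (measurableT_comp (@measurable_expR R) m2).
  exact: (measurableT_comp mk measurable_snd).
have F0 z : (0 <= F z)%E.
  rewrite lee_fin; apply: mulr_ge0; first by rewrite !indicE mulr_ge0// ler0n.
  by apply: mulr_ge0; [exact: expR_ge0|exact: spectral_term_ge0].
have T := @fubini_tonelli _ _ _ _ R mu mu F mF F0.
have E1 : (\int[mu]_t \int[mu]_u F (t, u) = \int[mu]_(t in D) (expR (- (r * t)) * spectral t)%:E)%E.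
  rewrite [RHS]integral_mkcond; apply: eq_integral => t _.
  rewrite patchE /F /=; case: ifP => tD; last first.
    by apply: integral0_eq => u _; rewrite indicE tD !mul0r.
  have t0 : 0 < t by move: tD; rewrite inE /= in_itv/= andbT.
  rewrite EFinM -pos_EFin_Rintegral; last exact/integrable_spectral/ltW.
  rewrite -ge0_integralZl//=.
  - rewrite [RHS]integral_mkcond; apply: eq_integral => u _.
    rewrite patchE !indicE tD; case: ifP => uD; last by rewrite mulr0 mul0r.
    by rewrite !mul1r EFinM.
  - apply/measurable_EFinP; apply: measurable_pos_continuous => u.
    exact: continuous_spectral_term.
  - by move=> u _; exact: spectral_term_ge0.
have E2 : (\int[mu]_u \int[mu]_t F (t, u) =
   \int[mu]_(u in D) (((1 + 2 * c * u + u ^+ 2) * (r + u `^ b))^-1)%:E)%E.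
  rewrite [RHS]integral_mkcond; apply: eq_integral => u _.
  rewrite patchE /F /=; case: ifP => uD; last first.
    by apply: integral0_eq => t _; rewrite !indicE uD mulr0 mul0r.
  have u0 : 0 < u by move: uD; rewrite inE /= in_itv/= andbT.
  have q0 : 0 < r + u `^ b by rewrite addr_gt0 ?powR_gt0.
  rewrite invfM EFinM -(pos_integral_exp q0).
  rewrite -ge0_integralZl//=.
  - rewrite [RHS]integral_mkcond; apply: eq_integral => t _.
    rewrite patchE !indicE uD; case: ifP => tD; last by rewrite !mul0r.
    rewrite -EFinM !mul1r /kern; congr EFin.
    have -> : - ((r + u `^ b) * t) = - (r * t) + - (u `^ b * t) by ring.
    by rewrite expRD; ring.
  - apply/measurable_EFinP; apply: measurable_pos_continuous => t _.
    exact: continuous_expRZ.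
  - by apply: ltW; exact: (kern_gt0 b1).
have ik := integrable_ray_kernel b1 1 r0.
have ik2 : mu.-integrable D (EFin \o (fun u => ((1 + 2 * c * u + u ^+ 2) * (r + u `^ b))^-1)).
  by apply: eq_pos_integrable ik => u _; rewrite mul1r.
rewrite E1 E2 (pos_EFin_Rintegral ik2) in T.
split; last by rewrite /Rintegral T.
apply: (@integrable_ge0_fin _ _ _ _ _ _ _ T) => //.
- apply: measurable_pos_continuous => t t0.
  by apply: cvgM; [exact: continuous_expRZ|exact: continuous_spectral].
- by move=> t _; rewrite mulr_ge0 ?expR_ge0 ?spectral_ge0.
Qed.

End SpectralIntegral.

(** * The spectral representation *)

Section SpectralRepresentation.
Variables (R : realType) (b : R).
Hypothesis (b1 : 1 < b).
Local Notation mu := (@lebesgue_measure R).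
Local Notation D := (`]0, +oo[%classic : set R).
Local Notation a := (b^-1).
Implicit Types t r x : R.

Let b0 : 0 < b. Proof. exact: lt_trans b1. Qed.
Let a0 : 0 < a. Proof. by rewrite invr_gt0. Qed.

Let K : R := \int[mu]_(u in D) (1 + u `^ b)^-1.
Let f t : R := MittagLeffler a (- t `^ a).

Let continuous_f t : 0 < t -> {for t, continuous f}.
Proof.
move=> t0; apply: (@continuous_ML_comp R a a0 (fun t => - t `^ a) t).
by apply: cvgN; exact: continuous_powR_pos.
Qed.

(** Both functions have the same Laplace transform at every r > 1, up to the
factor. *)
Lemma spectral_proportional t : 0 < t -> spectral b t = K * f t.
Proof.
move=> t0; apply/eqP; rewrite -subr_eq0.
(* the weight exp (- 2 t) makes every moment a transform at some r = n + 2 > 1 *)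
pose phi t := expR (- (2 * t)) * spectral b t - K * (expR (- (2 * t)) * f t).
have phiE x : phi x = expR (- (2 * x)) * (spectral b x - K * f x) by rewrite /phi; ring.
suff : phi t = 0.
  by rewrite phiE => /eqP; rewrite mulf_eq0 expR_eq0.
have expnE (g : R -> R) n : forall x : R, 0 < x ->
    expR (- (2 + n%:R) * x) * g x = expR (- x) ^+ n * (expR (- (2 * x)) * g x).
  move=> x _; rewrite mulrA -expRM_natl -expRD; congr (expR _ * _); ring.
have n1 (n : nat) : (1 : R) < 2 + n%:R.
  by rewrite (@lt_le_trans _ _ 2) ?ltr1n// lerDl.
apply: exp_moments_eq0 => //.
- move=> x x0; apply: cvgB.
    by apply: cvgM; [exact: continuous_expRZ|exact: continuous_spectral].
  apply: cvgM; first exact: cvg_cst.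
  by apply: cvgM; [exact: continuous_expRZ|exact: continuous_f].
- apply: pos_integrableB.
    have r2 : 0 < 2 :> R by [].
    by have [] := laplace_spectral b1 r2.
  apply: pos_integrableZ; apply: integrable_laplace_ML => //; by rewrite ltr1n.
- move=> n; pose r : R := 2 + n%:R; have r1 : 1 < r by exact: n1.
  have r0 : 0 < r by exact: lt_trans r1.
  have [i1 e1] := laplace_spectral b1 r0.
  have i2 := integrable_laplace_ML a0 r1.
  have e2 := laplace_ML a0 r1.
  have E x : 0 < x -> expR (- (r * x)) * spectral b x - K * (expR (- (r * x)) * f x)
      = expR (- x) ^+ n * phi x.
    move=> x0; have h1 := expnE (spectral b) n x x0; have h2 := expnE f n x x0.
    rewrite mulNr -/r in h1; rewrite mulNr -/r in h2; rewrite h1 h2 /phi; ring.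
  rewrite -(eq_pos_Rintegral E) pos_RintegralB//; last exact: pos_integrableZ.
  rewrite pos_RintegralZ// e1 e2 stieltjes_kernel//.
  by rewrite -/K subrr.
Qed.

(** The limit of [spectral_proportional] at t = 0. *)
Lemma spectral_constant : K = (pi / b) / sin (pi / b).
Proof.
have h0 n : 0 < harmonic n :> R by rewrite /harmonic /= invr_gt0.
have h1 : spectral b (harmonic n) @[n --> \oo] --> (pi / b) / sin (pi / b).
  by apply: spectral_cvg0 => //; [move=> n; exact: ltW|exact: cvg_harmonic].
have h2 : K * f (harmonic n) @[n --> \oo] --> K * 1.
  apply: cvgM; first exact: cvg_cst.
  have hN : - (harmonic n `^ a) @[n --> \oo] --> (0 : R).
    rewrite -[X in _ --> X]oppr0; apply: cvgN.
    apply: ((cvg_at_rightP (@powR R ^~ a) 0 0).1 (powR_cvg0 a0) harmonic).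
    by split => //; exact: cvg_harmonic.
  rewrite -(MittagLeffler0 a0).
  exact: (cvg_comp _ (MittagLeffler a) hN (@continuous_MittagLeffler R a a0 0)).
have E n : spectral b (harmonic n) = K * f (harmonic n) by exact: spectral_proportional.
rewrite (funext E) in h1.
transitivity (K * 1); first by rewrite mulr1.
exact: (cvg_unique _ h2 h1).
Qed.

Lemma MittagLeffler_spectral x : 0 < x ->
  MittagLeffler a (- x) = sin (pi / b) / (pi / b) * spectral b (x `^ b).
Proof.
move=> x0; rewrite spectral_proportional ?powR_gt0// spectral_constant /f.
rewrite -powRrM mulfV ?gt_eqF// powRr1 ?ltW//.
have v0 : 0 < pi / b by rewrite divr_gt0 ?pi_gt0.
have s0 := sin_pib_gt0 b1.
move: (pi / b) (sin _) v0 s0 => v s v0 s0.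
by field; rewrite (gt_eqF v0) (gt_eqF s0).
Qed.

Lemma integrable_expRNpow t : 0 < t -> mu.-integrable D (EFin \o (fun u => expR (- (u `^ b * t)))).
Proof.
move=> t0; apply: (integrable_pos_le _ (pos_integrableZ (expR t) (pos_integrable_exp t0))).
  apply: measurable_pos_continuous => u u0.
  apply: (cvg_comp (fun u : R => - (u `^ b * t)) expR); last exact: continuous_expR.
  by apply: cvgN; apply: cvgM; [exact: continuous_powR_pos|exact: cvg_cst].
move=> u u0; rewrite ger0_norm ?expR_ge0// -expRD ler_expR.
have [u1|u1] := leP u 1.
  have := powR_ge0 u b; nra.
have : u <= u `^ b by rewrite le1r_powR ?(ltW b1)// ltW.
nra.
Qed.

(** The substitutions u = r^a and r -> t r turn the integral into Gamma a. *)
Lemma integral_expRNpow t : 0 < t ->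
  \int[mu]_(u in D) expR (- (u `^ b * t)) = a * Gamma a / t `^ a.
Proof.
move=> t0.
have c1 (u : R) : 0 < u -> {for u, continuous (fun u => expR (- (u `^ b * t)))}.
  move=> u0; apply: (cvg_comp (fun u : R => - (u `^ b * t)) expR); last exact: continuous_expR.
  by apply: cvgN; apply: cvgM; [exact: continuous_powR_pos|exact: cvg_cst].
have ta : 0 < t `^ (a - 1) by rewrite powR_gt0.
pose k := a / t `^ (a - 1); have k0 : 0 < k by rewrite divr_gt0.
have g0 r : 0 < r -> 0 <= gamma_term (a - 1) r by rewrite mulr_ge0 ?powR_ge0 ?expR_ge0.
have S : (\int[mu]_(u in D) (expR (- (u `^ b * t)))%:E =
    (k * t^-1)%:E * \int[mu]_(r in D) (gamma_term (a - 1) r)%:E)%E.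
  rewrite (@pos_substitution R (@powR R ^~ a) (fun r => a * r `^ (a - 1))
    (fun u => expR (- (u `^ b * t)))).
  - rewrite EFinM -muleA -(pos_scaling t0 (@continuous_gamma_term R (a - 1)) g0).
    rewrite -ge0_integralZl//=.
    + apply: eq_integral => r; rewrite inE /= in_itv/= andbT => r0.
      rewrite -powRrM mulVf ?gt_eqF// powRr1 ?(ltW r0)// -EFinM; congr EFin.
      rewrite /gamma_term powRM ?(ltW t0) ?(ltW r0)// /k (mulrC t r).
      by move: (a) ta => a' ta; field; rewrite gt_eqF.
    + apply/measurable_EFinP; apply: measurable_pos_continuous => r r0.
      apply: (cvg_comp (fun r => t * r) (gamma_term (a - 1))).
        by apply: cvgM; [exact: cvg_cst|exact: cvg_id].
      by apply: continuous_gamma_term; rewrite mulr_gt0.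
    + move=> r; rewrite /= in_itv/= andbT => r0.
      by apply: g0; rewrite mulr_gt0.
    + exact: ltW.
  - by move=> r r0; rewrite powR_gt0.
  - by move=> r r0; rewrite mulr_gt0 ?powR_gt0.
  - by move=> r r0; apply: cvgM; [exact: cvg_cst|exact: continuous_powR_pos].
  - exact: powR_cvg0.
  - apply/cvgryPge => A; near=> y.
    have Ay : Num.max 1 A `^ b < y by near: y; apply: nbhs_pinfty_gt; rewrite num_real.
    have m0 : 0 <= Num.max 1 A by rewrite le_max ler01.
    rewrite (@le_trans _ _ (Num.max 1 A))//; first by rewrite le_max lexx orbT.
    rewrite -[leLHS]powRr1// -(mulfV (lt0r_neq0 b0)) powRrM.
    by rewrite ge0_ler_powR ?nnegrE ?powR_ge0 ?(ltW a0) ?(ltW Ay)//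
      (le_trans (powR_ge0 _ _) (ltW Ay)).
  - exact: c1.
  - by move=> u _; exact: expR_ge0.
have kt : k * t^-1 = a / t `^ a.
  rewrite /k -(mulr_powRB1 (ltW t0) a0); field.
  by rewrite !gt_eqF.
rewrite /Rintegral S kt.
have -> : Gamma a = fine (\int[mu]_(r in D) (gamma_term (a - 1) r)%:E)%E by [].
have : (0 <= \int[mu]_(r in D) (gamma_term (a - 1) r)%:E)%E.
  apply: integral_ge0 => r; rewrite /= in_itv/= andbT => r0.
  by rewrite lee_fin; exact: g0.
(* if this integral were +oo, both sides would be fine +oo = 0 *)
case: (\int[mu]_(r in D) (gamma_term (a - 1) r)%:E)%E => [y|_|//] /=.
  by move=> _; ring.
by rewrite gt0_muley ?lte_fin ?divr_gt0 ?powR_gt0//= mulr0 mul0r.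
Unshelve. all: by end_near. Qed.

End SpectralRepresentation.

(** * The two bounds *)

Section Bounds.
Variables (R : realType) (b : R).
Hypothesis (b1 : 1 < b).
Local Notation mu := (@lebesgue_measure R).
Local Notation D := (`]0, +oo[%classic : set R).
Local Notation v := (pi / b).
Local Notation c := (cos v).
Local Notation s := (sin v).
Implicit Types t u : R.

Let b0 : 0 < b. Proof. exact: lt_trans b1. Qed.
Let s0 : 0 < s. Proof. exact: sin_pib_gt0. Qed.
Let v0 : 0 < v. Proof. by rewrite divr_gt0 ?pi_gt0. Qed.

Lemma Rintegral01_le (f h : R -> R) : continuous f ->
  mu.-integrable D (EFin \o h) -> (forall u, 0 < u -> 0 <= h u) ->
  (forall u, 0 < u -> u <= 1 -> f u <= h u) ->
  \int[mu]_(u in `[0, 1]) f u <= \int[mu]_(u in D) h u.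
Proof.
move=> cf jh h0 fh.
have i01 : mu.-integrable `[0, 1] (EFin \o f).
  apply: continuous_compact_integrable; first exact: segment_compact.
  exact: continuous_subspaceT.
have i01' : mu.-integrable `]0, 1] (EFin \o f).
  by apply: integrableS i01 => //; exact: subset_itv_oc_cc.
have sub : `]0, 1]%classic `<=` D by exact: subset_itvl.
rewrite -Rintegral_itv_obnd_cbnd// -(setIidr sub) Rintegral_mkcondr.
apply: le_pos_Rintegral => //.
- rewrite (_ : EFin \o _ = (EFin \o f) \_ `]0, 1]).
    by apply/integrable_restrict => //; rewrite setIidr.
  by apply/funext => u; rewrite /= !patchE; case: ifP.
- move=> u u0; rewrite patchE; case: ifP => [|_]; last exact: h0.
  by rewrite inE /= in_itv/= u0 /= => u1; exact: fh.
Qed.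

Lemma spectral_lower t : 0 <= t -> expR (- t) * (v / 2 / s) <= spectral b t.
Proof.
move=> t0; rewrite -(kern_integral01 b1).
have ck := continuous_kern b1.
have i01 : mu.-integrable `[0, 1] (EFin \o kern b).
  apply: continuous_compact_integrable; first exact: segment_compact.
  exact: continuous_subspaceT.
have <- : \int[mu]_(u in `[0, 1]) (expR (- t) * kern b u) =
    expR (- t) * \int[mu]_(u in `[0, 1]) kern b u by apply: RintegralZl.
apply: Rintegral01_le.
- by move=> u; apply: cvgM; [exact: cvg_cst|exact: ck].
- exact: integrable_spectral.
- by move=> u u0; rewrite mulr_ge0 ?expR_ge0// ltW// kern_gt0.
- move=> u u0 u1; rewrite ler_wpM2r ?(ltW (kern_gt0 b1 u))// ler_expR lerN2.
  rewrite ler_piMl//; have := @ge0_ler_powR R b (ltW b0) u 1.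
  by rewrite powR1; apply; rewrite ?nnegrE ?(ltW u0).
Qed.

Lemma spectral_upper t : 0 < t -> 0 < c ->
  spectral b t <= b^-1 * Gamma b^-1 / t `^ b^-1 - expR (- t) * (c / (1 + c)) / 2.
Proof.
move=> t0 c0; rewrite -integral_expRNpow// lerBrDr -lerBrDl.
have iA := integrable_expRNpow b1 t0.
have ig := integrable_spectral b1 (ltW t0).
rewrite /spectral -pos_RintegralB//.
have c10 : 0 < 1 + c by rewrite addr_gt0.
pose q := expR (- t) * (c / (1 + c)).
have q0 : 0 <= q by rewrite mulr_ge0 ?expR_ge0// divr_ge0// ltW.
have <- : \int[mu]_(u in `[0, 1]) (q * u) = q / 2.
  have d (u : R) : is_derive u 1 (fun u => q / 2 * u ^+ 2) (q * u).
    have := is_deriveZ (q / 2) (is_deriveX 2 (is_derive_id u 1)).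
    by move/is_derive_eq; apply; rewrite /GRing.scale /=; field.
  rewrite /Rintegral (continuous_FTC2 ltr01 (F := fun u => q / 2 * u ^+ 2)).
  - by rewrite /= expr0n expr1n /=; ring.
  - apply: continuous_subspaceT => u; apply: cvgM; [exact: cvg_cst|exact: cvg_id].
  - split.
    + by move=> x _; have [] := d x.
    + have [+ _] := d 0; move=> /derivable1_diffP/differentiable_continuous.
      exact: cvg_at_right_filter.
    + have [+ _] := d 1; move=> /derivable1_diffP/differentiable_continuous.
      exact: cvg_at_left_filter.
  - by move=> x _; rewrite derive1E; have [_] := d x.
(* the part of the Gamma integral that the denominator removes *)
have hE u : expR (- (u `^ b * t)) - expR (- (u `^ b * t)) * kern b u =
    expR (- (u `^ b * t)) * (1 - kern b u) by ring.
have kE u : 1 - kern b u = (2 * c * u + u ^+ 2) * kern b u.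
  by rewrite /kern; field; rewrite gt_eqF// kernel_den_gt0.
apply: Rintegral01_le.
- by move=> u; apply: cvgM; [exact: cvg_cst|exact: cvg_id].
- exact: pos_integrableB.
- move=> u u0; rewrite hE kE mulr_ge0 ?expR_ge0// mulr_ge0 ?(ltW (kern_gt0 b1 u))//.
  by rewrite addr_ge0 ?sqr_ge0// !mulr_ge0 ?(ltW c0) ?(ltW u0).
- move=> u u0 u1; rewrite hE /q -mulrA; apply: ler_pM.
  + exact: expR_ge0.
  + by rewrite mulr_ge0 ?(ltW u0)// divr_ge0 ?(ltW c0) ?(ltW c10).
  + rewrite ler_expR lerN2 ler_piMl ?(ltW t0)//.
    have := @ge0_ler_powR R b (ltW b0) u 1.
    by rewrite powR1; apply; rewrite ?nnegrE ?(ltW u0).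
  + rewrite kE /kern mulrAC ler_pdivrMr// mulrAC ler_pdivlMr ?kernel_den_gt0//.
    have uc : 0 < u * c by rewrite mulr_gt0.
    have u2 : 0 <= u ^+ 2 by exact: sqr_ge0.
    have u3 : u ^+ 2 <= 1 by rewrite expr_le1// ltW.
    have : 1 + 2 * c * u + u ^+ 2 <= 2 * (1 + c) by nra.
    nra.
Qed.

End Bounds.

Theorem mainTheorem17 (R : realType) (x : R) (hx : 0 < x) :
  (forall a : R, 0 < a -> a < 1 ->
     MittagLeffler a (- x) >= (1 / 2) * expR (- (x `^ (1 / a)))) /\
  (forall a : R, 0 < a -> a < 1 / 2 ->
     (sin (pi * a) / pi) * (Gamma a / x)
       - (expR (- (x `^ (1 / a))) / (4 * a * pi))
         * (sin (2 * pi * a) / (1 + cos (pi * a)))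
       >= MittagLeffler a (- x)
     /\ MittagLeffler a (- x) >= (1 / 2) * expR (- (x `^ (1 / a)))).
Proof.
have lower a : 0 < a -> a < 1 ->
    MittagLeffler a (- x) >= (1 / 2) * expR (- (x `^ (1 / a))).
  move=> a0 a1; have b1 : 1 < a^-1 by rewrite invf_gt1.
  have := MittagLeffler_spectral b1 hx; rewrite invrK => ->.
  have := spectral_lower b1 (powR_ge0 x a^-1).
  rewrite !div1r invrK.
  have v0 : 0 < pi * a by rewrite mulr_gt0 ?pi_gt0.
  have s0 : 0 < sin (pi * a) by have := sin_pib_gt0 b1; rewrite invrK.
  move: (pi * a) (sin _) v0 s0 => v s v0 s0.
  move=> h; apply: (@le_trans _ _ (s / v * (expR (- x `^ a^-1) * (v / 2 / s)))).
    rewrite le_eqVlt; apply/orP; left; apply/eqP; field.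
    by rewrite (gt_eqF v0) (gt_eqF s0).
  by rewrite ler_pM2l// divr_gt0.
split => // a a0 a12; have a1 : a < 1 by lra.
split; last exact: lower.
have b1 : 1 < a^-1 by rewrite invf_gt1.
have := MittagLeffler_spectral b1 hx; rewrite invrK => ->.
have v0 : 0 < pi * a by rewrite mulr_gt0 ?pi_gt0.
have s0 : 0 < sin (pi * a) by have := sin_pib_gt0 b1; rewrite invrK.
have c0 : 0 < cos (pi * a).
  have := pi_gt0 R => p0; apply: cos_gt0_pihalf; apply/andP; split; first lra.
  by rewrite ltr_pM2l//; lra.
have := spectral_upper b1 (powR_gt0 a^-1 hx).
rewrite !invrK -powRrM mulVf ?gt_eqF// powRr1 ?(ltW hx)// !div1r => /(_ c0) h.
apply: (@le_trans _ _ (sin (pi * a) / (pi * a) *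
   (a * Gamma a / x - expR (- x `^ a^-1) * (cos (pi * a) / (1 + cos (pi * a))) / 2))).
  by rewrite ler_pM2l// divr_gt0.
have -> : sin (2 * pi * a) = 2 * sin (pi * a) * cos (pi * a).
  by rewrite -mulrA mulrC mulr_natr sin_mulr2n mulr2n; ring.
have c1 : 0 < 1 + cos (pi * a) by rewrite addr_gt0.
have p0 := pi_gt0 R.
rewrite le_eqVlt; apply/orP; left; apply/eqP.
move: (cos (pi * a)) (sin (pi * a)) (Gamma a) (expR _) c1 => C S G E c1.
move: (pi : R) p0 => p p0.
by field; rewrite (gt_eqF c1) (gt_eqF hx) (gt_eqF a0) (gt_eqF p0).
Qed.
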